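(* Fix $0<q<1$. Let $G$ be a finite abelian group and let $\langle\cdot,\cdot\rangle_{\hat G}$ be a symmetric pairing (not necessarily perfect) on $\hat G=\mathrm{Hom}(G,\mathbb Q/\mathbb Z)$. For a random graph $\Gamma\in G(n,q)$ with sandpile group $S$ and canonical symmetric pairing $\langle\cdot,\cdot\rangle_{\hat S}$ on $\hat S=\mathrm{Hom}(S,\mathbb Q/\mathbb Z)$, we have \[\lim_{n\to\infty}\mathbb E\big(\#\mathrm{Sur}^*(S,G)\big)=\frac{1}{|G|}.\]
   Context: $G(n,q)$: random simple graph on $\{1,\dots,n\}$ with edges independently present with probability $q$. Laplacian $L$: $L_{ij}=1$ if $i\neq j$ adjacent, $0$ if $i\ne j$ nonadjacent, $L_{ii}=-\deg(i)$. $Z\subset\mathbb Z^n$ is the subgroup of vectors with coordinate sum $0$, and $S=Z/L\mathbb Z^n$. For a symmetric integer matrix $M$, elements of $\mathrm{Hom}(\mathrm{cok}(M),\mathbb Q/\mathbb Z)$ (with $\mathrm{cok}(M)=\mathbb Z^n/M\mathbb Z^n$) are maps $\phi:\mathbb Z^n\to\mathbb Q/\mathbb Z$ with $\phi M=0$; the pairing $\langle\cdot,\cdot\rangle_M$ on this group is $\langle x,y\rangle_M=XMY^t\bmod\mathbb Z$, where $X,Y\in\mathbb Q^n$ (row vectors) are lifts of $x,y$. The canonical pairing on $\hat S$ is defined by: for $x,y\in\hat S$ choose extensions $\tilde x,\tilde y\in\mathrm{Hom}(\mathrm{cok}(L),\mathbb Q/\mathbb Z)$ (restriction along $S\hookrightarrow\mathrm{cok}(L)$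 is surjective) and set $\langle x,y\rangle_{\hat S}=\langle\tilde x,\tilde y\rangle_L$; this is well defined. For a homomorphism $F:A\to B$ its transpose is $F^t:\hat B\to\hat A$, $\ell\mapsto\ell\circ F$. $\mathrm{Sur}^*(S,G)$ is the set of surjective homomorphisms $F:S\to G$ such that $\langle F^t(u),F^t(v)\rangle_{\hat S}=\langle u,v\rangle_{\hat G}$ for all $u,v\in\hat G$. *)

(* Defs.v *)
From HB Require Import structures.
From mathcomp Require Import all_boot all_order all_algebra.
From mathcomp Require Import finmap.
From mathcomp Require Import all_classical all_reals all_analysis.
Set Implicit Arguments.
Unset Strict Implicit.
Unset Printing Implicit Defensive.
Import Order.TTheory GRing.Theory Num.Theory.
Local Open Scope ring_scope.
Local Open Scope quotient_scope.

(* Hom(A, B) as an abelian group under pointwise addition; equality and choice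
   are classical. *)
HB.instance Definition _ (A B : zmodType) :=
  gen_eqMixin {additive A -> B}.
HB.instance Definition _ (A B : zmodType) :=
  gen_choiceMixin {additive A -> B}.

Section HomGroup.
Variables A B : zmodType.
Implicit Types f g h : {additive A -> B}.

Lemma additive_ext f g : f =1 g -> f = g.
Proof.
case: f g => [f [[F]]] [g [[G]]] /= /funext e; case: _ / e in G *.
by rewrite (Prop_irrelevance F G).
Qed.

Definition hom_zero : {additive A -> B} := \0.
Definition hom_opp f : {additive A -> B} := \- f.
Definition hom_add f g : {additive A -> B} := f \+ g.

Fact hom_addA : associative hom_add.
Proof. by move=> f g h; apply: additive_ext => x; rewrite /= addrA. Qed.
Fact hom_addC : commutative hom_add.
Proof. by move=> f g; apply: additive_ext => x; rewrite /= addrC. Qed.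
Fact hom_add0 : left_id hom_zero hom_add.
Proof. by move=> f; apply: additive_ext => x; rewrite /= add0r. Qed.
Fact hom_addN : left_inverse hom_zero hom_opp hom_add.
Proof. by move=> f; apply: additive_ext => x; rewrite /= addNr. Qed.

HB.instance Definition _ := GRing.isZmodule.Build {additive A -> B}
  hom_addA hom_addC hom_add0 hom_addN.

End HomGroup.

Definition int_in_rat : {pred rat} := fun a => a \is a Num.int.

Fact int_in_rat_zmod_closed : zmod_closed int_in_rat.
Proof. by split=> [|a b]; rewrite /in_mem /= ?rpred0 //; apply: rpredB. Qed.
HB.instance Definition _ :=
  GRing.isZmodClosed.Build rat int_in_rat int_in_rat_zmod_closed.

Notation QmodZ := {ideal_quot int_in_rat}.

Notation dualQZ A := {additive A -> QmodZ}.

Definition transpose (A B : zmodType) (F : {additive A -> B}) (l : dualQZ B) :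
  dualQZ A := l \o F.

Definition symmetric_pairing (A : zmodType) (b : A -> A -> QmodZ) : Prop :=
  [/\ forall x, zmod_morphism (b x),
      forall y, zmod_morphism (b^~ y)
    & forall x y, b x y = b y x].

(* M Z^n for column vectors; membership is made boolean classically so that the
   quotient construction applies to it. *)
Definition col_image n (M : 'M[int]_n) : {pred 'cV[int]_n} :=
  fun v => `[< exists w, v = M *m w >].

Fact col_image_zmod_closed n (M : 'M[int]_n) : zmod_closed (col_image M).
Proof.
split=> [|u v]; first by apply/asboolP; exists 0; rewrite mulmx0.
by move=> /asboolP[x ->] /asboolP[y ->]; apply/asboolP; exists (x - y); rewrite mulmxBr.
Qed.
HB.instance Definition _ n (M : 'M[int]_n) :=
  GRing.isZmodClosed.Build 'cV[int]_n (col_image M) (col_image_zmod_closed M).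

Notation cok M := {ideal_quot (col_image M)}.

Section CokernelPairing.
Variables (n : nat) (M : 'M[int]_n).
Implicit Types (x y : dualQZ (cok M)) (X Y : 'rV[rat]_n).

(* A homomorphism on cok(M) is identified with the map Z^n -> Q/Z obtained by
   precomposing with the projection; the row X in Q^n lifts it when X_i mod Z is
   its value on the i-th basis vector. *)
Definition is_lift x X : Prop :=
  forall i, \pi_QmodZ (X 0 i) = x (\pi_(cok M) (delta_mx i 0)).

Definition lift_row x : 'rV[rat]_n :=
  \row_i repr (x (\pi_(cok M) (delta_mx i 0))).

(* XMY^t mod Z for the lifts chosen by repr; cok_pairingE shows that, for
   symmetric M, any other lifts give the same value. *)
Definition cok_pairing x y : QmodZ :=
  \pi_QmodZ ((lift_row x *m map_mx intr M *m (lift_row y)^T) 0 0).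

Lemma piQZ_eq (a b : rat) : (\pi_QmodZ a = \pi_QmodZ b) <-> a - b \is a Num.int.
Proof.
split=> [/eqP|h]; first by rewrite -Quotient.idealrBE.
by apply/eqP; rewrite -Quotient.idealrBE.
Qed.

Lemma piQZ_eq0 (a : rat) : (\pi_QmodZ a = 0) <-> a \is a Num.int.
Proof. by rewrite -[X in X \is a _]subr0 -piQZ_eq raddf0. Qed.

Lemma lift_rowP x : is_lift x (lift_row x).
Proof. by move=> i; rewrite mxE reprK. Qed.

Lemma is_lift_eval x X (v : 'cV[int]_n) : is_lift x X ->
  \pi_QmodZ ((X *m map_mx intr v) 0 0) = x (\pi_(cok M) v).
Proof.
move=> hX; rewrite {2}[v]matrix_sum_delta mxE !raddf_sum /=.
apply: eq_bigr => i _; rewrite big_ord1 mxE -[X in X *: _]intz scaler_int.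
by rewrite mulrzr !raddfMz /= -hX.
Qed.

Lemma is_lift_mul x X (v : 'cV[int]_n) :
  is_lift x X -> (X *m map_mx intr M *m map_mx intr v) 0 0 \is a Num.int.
Proof.
move=> hX; rewrite -mulmxA -map_mxM; apply/piQZ_eq0; rewrite (is_lift_eval _ hX).
rewrite -[RHS](raddf0 x); congr (x _); rewrite -[RHS](raddf0 (\pi_(cok M))).
apply/eqP; rewrite -Quotient.idealrBE subr0; apply/asboolP; by exists v.
Qed.

End CokernelPairing.

Lemma int_matrixP m n (X : 'M[rat]_(m, n)) : (forall i j, X i j \is a Num.int) ->
  exists v : 'M[int]_(m, n), X = map_mx intr v.
Proof.
move=> h; exists (\matrix_(i, j) Num.floor (X i j)); apply/matrixP => i j.
by rewrite !mxE; apply/esym/eqP; rewrite -intrEfloor.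
Qed.

Lemma cok_pairingE n (M : 'M[int]_n) (x y : dualQZ (cok M)) X Y : M^T = M ->
  is_lift x X -> is_lift y Y ->
  cok_pairing x y = \pi_QmodZ ((X *m map_mx intr M *m Y^T) 0 0).
Proof.
move=> symM hX hY; apply/piQZ_eq.
have := lift_rowP x; have := lift_rowP y.
move: (lift_row x) (lift_row y) => X' Y' hY' hX'.
have [u Hu] : exists u : 'rV[int]_n, X' - X = map_mx intr u.
  apply: int_matrixP => i j; rewrite ord1 !mxE; apply/piQZ_eq.
  by rewrite hX' hX.
have [v Hv] : exists v : 'rV[int]_n, Y' - Y = map_mx intr v.
  apply: int_matrixP => i j; rewrite ord1 !mxE; apply/piQZ_eq.
  by rewrite hY' hY.
have sub00 (A B : 'M[rat]_1) : (A - B) 0 0 = A 0 0 - B 0 0 by rewrite !mxE.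
have -> : (X' *m map_mx intr M *m Y'^T) 0 0 - (X *m map_mx intr M *m Y^T) 0 0
  = (X' *m map_mx intr M *m (Y' - Y)^T) 0 0 + ((X' - X) *m map_mx intr M *m Y^T) 0 0.
  by rewrite linearB /= mulmxBr !mulmxBl !sub00 addrA subrK.
apply: rpredD; first by rewrite Hv map_trmx; apply: is_lift_mul hX'.
rewrite Hu (_ : (_ *m Y^T) 0 0 = (map_mx intr u *m map_mx intr M *m Y^T)^T 0 0); last by rewrite [RHS]mxE.
rewrite 2!trmx_mul trmxK !map_trmx symM mulmxA.
exact: is_lift_mul hY.
Qed.

Definition sum0 n : {pred 'cV[int]_n} := fun v => \sum_i v i 0 == 0.

Fact sum0_zmod_closed n : zmod_closed (@sum0 n).
Proof.
split=> [|u v]; rewrite /in_mem /= /sum0.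
  by rewrite big1 // => i _; rewrite mxE.
move=> /eqP hu /eqP hv; under eq_bigr do rewrite !mxE.
by rewrite sumrB hu hv subrr.
Qed.
HB.instance Definition _ n :=
  GRing.isZmodClosed.Build 'cV[int]_n (@sum0 n) (sum0_zmod_closed n).

Record Zsum0 n := MkZsum0 {Zsum0_val :> 'cV[int]_n; _ : Zsum0_val \in @sum0 n}.

HB.instance Definition _ n := [isSub for @Zsum0_val n].
HB.instance Definition _ n := [Choice of Zsum0 n by <:].
HB.instance Definition _ n := [SubChoice_isSubZmodule of Zsum0 n by <:].

Definition vpairs n : {set {set 'I_n}} := [set e : {set 'I_n} | #|e| == 2%N]%SET.

Definition sgraph n := {E : {set {set 'I_n}} | E \subset vpairs n}.

Section Sandpile.
Variables (n : nat) (g : sgraph n).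

(* Loop-free, because [set i; i] is not an element of vpairs n. *)
Definition adj : rel 'I_n := fun i j => ([set i; j]%SET \in val g).

Definition deg (i : 'I_n) : nat := #|[set j | adj i j]%SET|.

Definition laplacian : 'M[int]_n :=
  \matrix_(i, j) if i == j then - (deg i)%:Z else (adj i j : nat)%:Z.

(* L Z^n as a subgroup of Z; it is all of L Z^n by col_image_laplacian_sum0. *)
Definition lap_image : {pred Zsum0 n} := fun z => val z \in col_image laplacian.

Fact lap_image_zmod_closed : zmod_closed lap_image.
Proof.
split=> [|u v]; rewrite /in_mem /= /lap_image ?raddf0 ?rpred0 //.
by rewrite raddfB; apply: rpredB.
Qed.
HB.instance Definition _ :=
  GRing.isZmodClosed.Build (Zsum0 n) lap_image lap_image_zmod_closed.

End Sandpile.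

Notation sandpile g := {ideal_quot (lap_image g)}.

Lemma quot_lift (V W : zmodType) (I : zmodClosed V) (f : {additive V -> W}) :
  (forall v, v \in I -> f v = 0) ->
  exists h : {additive {ideal_quot I} -> W},
    forall v, h (\pi_{ideal_quot I} v) = f v.
Proof.
move=> fI; pose h (c : {ideal_quot I}) := f (repr c).
have hE v : h (\pi_{ideal_quot I} v) = f v.
  apply/eqP; rewrite -subr_eq0 -raddfB; apply/eqP/fI.
  by rewrite Quotient.idealrBE reprK.
have hB : zmod_morphism h.
  move=> a b; rewrite -[a]reprK -[b]reprK -raddfB !hE; exact: raddfB.
pose hM := GRing.isZmodMorphism.Build _ _ h hB.
pose H : {additive {ideal_quot I} -> W} := HB.pack h hM.
by exists H.
Qed.

Section SandpilePairing.
Variables (n : nat) (g : sgraph n).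
Local Notation L := (laplacian g).

Lemma adj_sym : symmetric (adj g).
Proof. by move=> i j; rewrite /adj finset.setUC. Qed.

Lemma adj_irr : irreflexive (adj g).
Proof.
move=> i; apply/negP => hi; have := fintype.subsetP (valP g) _ hi.
by rewrite inE finset.setUid cards1.
Qed.

Lemma laplacian_sym : L^T = L.
Proof.
apply/matrixP => i j; rewrite !mxE eq_sym; case: eqP => [->//|_].
by rewrite adj_sym.
Qed.

Lemma sum_laplacian i : \sum_j L i j = 0.
Proof.
rewrite (bigD1 i) //= mxE eqxx.
suff -> : \sum_(j | j != i) L i j = (deg g i)%:Z by rewrite addNr.
rewrite /deg -sum1_card (big_morph Posz PoszD (erefl _)) big_mkcond [RHS]big_mkcond.
apply: eq_bigr => j _; rewrite inE mxE eq_sym.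
by case: eqP => [->|_] /=; [rewrite adj_irr | case: adj].
Qed.

Lemma lap_mul1 : L *m (const_mx 1 : 'cV_n) = 0.
Proof.
apply/colP => i; rewrite mxE [RHS]mxE -[RHS](sum_laplacian i).
by apply: eq_bigr => j _; rewrite [X in _ * X]mxE mulr1.
Qed.

Lemma mul1_lap : (const_mx 1 : 'rV_n) *m L = 0.
Proof. by apply: trmx_inj; rewrite trmx_mul laplacian_sym trmx_const lap_mul1 trmx0. Qed.

Lemma col_image_laplacian_sum0 v : v \in col_image L -> v \in @sum0 n.
Proof.
case/asboolP => w ->; rewrite /in_mem /= /sum0.
have /matrixP/(_ 0 0) : (const_mx 1 : 'rV_n) *m (L *m w) = 0.
  by rewrite mulmxA mul1_lap mul0mx.
rewrite mxE [RHS]mxE => h; apply/eqP; rewrite -[RHS]h.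
by apply: eq_bigr => i _; rewrite [X in X * _]mxE mul1r.
Qed.

Definition sandpile_incl_fun (s : sandpile g) : cok L :=
  \pi_(cok L) (val (repr s)).

Lemma sandpile_incl_funE (z : Zsum0 n) :
  sandpile_incl_fun (\pi_(sandpile g) z) = \pi_(cok L) (val z).
Proof.
apply/eqP; rewrite -Quotient.idealrBE -raddfB.
have : repr (\pi_(sandpile g) z) - z \in lap_image g.
  by rewrite Quotient.idealrBE reprK.
by [].
Qed.

Fact sandpile_incl_zmod_morphism : zmod_morphism sandpile_incl_fun.
Proof.
move=> s t; rewrite -[s]reprK -[t]reprK -raddfB !sandpile_incl_funE.
by rewrite !raddfB.
Qed.
HB.instance Definition _ := GRing.isZmodMorphism.Build (sandpile g) (cok L)
  sandpile_incl_fun sandpile_incl_zmod_morphism.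

Definition sandpile_incl : {additive sandpile g -> cok L} := sandpile_incl_fun.

Lemma sandpile_incl_inj : injective sandpile_incl.
Proof.
move=> s t; rewrite -[s]reprK -[t]reprK /sandpile_incl /= !sandpile_incl_funE.
move=> /eqP; rewrite -Quotient.idealrBE => h; apply/eqP.
by rewrite -Quotient.idealrBE /in_mem /= /lap_image raddfB.
Qed.

Definition restriction : dualQZ (cok L) -> dualQZ (sandpile g) :=
  transpose sandpile_incl.

(* A chosen preimage under restriction, which is onto (restriction_surj); the
   pairing below does not depend on the choice (sandpile_pairingE). *)
Definition extension (x : dualQZ (sandpile g)) : dualQZ (cok L) :=
  xget 0 [set t | restriction t = x]%classic.

Definition sandpile_pairing (x y : dualQZ (sandpile g)) : QmodZ :=
  cok_pairing (extension x) (extension y).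
End SandpilePairing.

Lemma restriction_surj n (g : sgraph n) x :
  exists t : dualQZ (cok (laplacian g)), restriction t = x.
Proof.
case: n g x => [|n] g x.
  exists 0; apply: additive_ext => s; rewrite /= -[s]reprK.
  have -> : repr s = 0 by apply: val_inj; rewrite [LHS]flatmx0 raddf0.
  by rewrite !raddf0.
pose sm (v : 'cV[int]_n.+1) := \sum_i v i 0.
pose pr (v : 'cV[int]_n.+1) := v - sm v *: delta_mx 0 0.
have smB u v : sm (u - v) = sm u - sm v.
  by rewrite /sm -sumrB; apply: eq_bigr => i _; rewrite !mxE.
have smZ c : sm (c *: delta_mx 0 0) = c.
  rewrite /sm (bigD1 0) //= big1 => [|i /negPf i0]; first by rewrite !mxE mulr1 addr0.
  by rewrite !mxE i0 mulr0.
have pr0 v : pr v \in @sum0 n.+1.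
  by apply/eqP; rewrite -/(sm _) smB smZ subrr.
pose f v := x (\pi_(sandpile g) (MkZsum0 (pr0 v))).
have fB : zmod_morphism f.
  move=> u v; rewrite /f -!raddfB; congr (x (\pi _)); apply: val_inj.
  by rewrite raddfB /= /pr smB scalerBl opprD addrACA -opprD.
pose F : {additive _ -> _} := HB.pack f (GRing.isZmodMorphism.Build _ _ f fB).
have prE (z : Zsum0 n.+1) : pr z = z.
  by case: z => z hz; rewrite /pr /= [sm z](eqP hz) scale0r subr0.
have [v vL|t tE] := @quot_lift _ _ (col_image (laplacian g)) F.
  have pv : pr v = v := prE (MkZsum0 (col_image_laplacian_sum0 vL)).
  rewrite /= /f -[RHS](raddf0 x) -[in RHS](raddf0 (\pi_(sandpile g))); congr (x _).
  by apply/eqP; rewrite -Quotient.idealrBE subr0 /in_mem /= /lap_image /= pv.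
exists t; apply: additive_ext => s; rewrite -[s]reprK /= sandpile_incl_funE tE /=.
by rewrite /f; congr (x (\pi _)); apply: val_inj; rewrite /= prE.
Qed.

Lemma extensionK n (g : sgraph n) (x : dualQZ (sandpile g)) :
  restriction (extension x) = x.
Proof. exact: (xgetPex 0 (restriction_surj x)). Qed.

Lemma restriction_lift n (g : sgraph n) (t u : dualQZ (cok (laplacian g))) X :
  restriction t = restriction u -> is_lift t X ->
  exists c, is_lift u (X + const_mx c).
Proof.
case: n g t u X => [|n] g t u X tu hX; first by exists 0 => - [].
pose d i := u (\pi_(cok (laplacian g)) (delta_mx i 0))
             - t (\pi_(cok (laplacian g)) (delta_mx i 0)).
have dE i : d i = d 0.
  have hz : delta_mx i 0 - delta_mx 0 0 \in @sum0 n.+1.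
    apply/eqP; under eq_bigr do rewrite !mxE.
    rewrite sumrB (bigD1 i) //= big1 => [|j /negPf ->//].
    by rewrite (bigD1 0) //= big1 => [|j /negPf ->//]; rewrite eqxx.
  have /(congr1 (fun f : dualQZ _ => f (\pi_(sandpile g) (MkZsum0 hz)))) := tu.
  rewrite /= sandpile_incl_funE /= !raddfB /= => e.
  by apply/eqP; rewrite /d subr_eq -addrA [- _ + _]addrC e addrC subrK.
exists (repr (d 0)) => i; rewrite !mxE raddfD /= reprK hX -(dE i).
by rewrite addrC subrK.
Qed.

Lemma sandpile_pairingE n (g : sgraph n) (x y : dualQZ (sandpile g)) t u :
  restriction t = x -> restriction u = y ->
  sandpile_pairing x y = cok_pairing t u.
Proof.
move=> tx uy; have hT := lift_rowP t; have hU := lift_rowP u.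
have [|c hc] := restriction_lift (u := extension x) _ hT; first by rewrite extensionK.
have [|d hd] := restriction_lift (u := extension y) _ hU; first by rewrite extensionK.
have symL := laplacian_sym g.
rewrite /sandpile_pairing (cok_pairingE symL hc hd) (cok_pairingE symL hT hU).
congr (\pi _).
have cE k l e : const_mx e = e *: (map_mx intr (const_mx 1) : 'M[rat]_(k, l)).
  by apply/matrixP => i j; rewrite !mxE mulr1.
rewrite mulmxDl [const_mx c]cE -scalemxAl -map_mxM mul1_lap map_mx0 scaler0 addr0.
rewrite linearD /= mulmxDr trmx_const [const_mx d]cE -scalemxAr.
rewrite -[X in _ + _ *: X]mulmxA -map_mxM.
by rewrite lap_mul1 map_mx0 mulmx0 scaler0 addr0.
Qed.

Lemma cok_pairing_sym n (M : 'M[int]_n) : M^T = M ->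
  symmetric_pairing (@cok_pairing n M).
Proof.
move=> symM.
have psym (x y : dualQZ (cok M)) : cok_pairing x y = cok_pairing y x.
  rewrite /cok_pairing; congr (\pi _).
  have tr00 (A : 'M[rat]_1) : A 0 0 = A^T 0 0 by rewrite mxE.
  by rewrite [LHS]tr00 2!trmx_mul trmxK map_trmx symM mulmxA.
have padd (x : dualQZ (cok M)) : zmod_morphism (cok_pairing x).
  move=> y z; have hX := lift_rowP x; have hY := lift_rowP y; have hZ := lift_rowP z.
  have hYZ : is_lift (y - z) (lift_row y - lift_row z).
    move=> i; have -> : (lift_row y - lift_row z) 0 i = lift_row y 0 i - lift_row z 0 i.
      by rewrite !mxE.
    by rewrite raddfB /= hY hZ.
  have sub00 (A B : 'M[rat]_1) : (A - B) 0 0 = A 0 0 - B 0 0 by rewrite !mxE.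
  rewrite (cok_pairingE symM hX hYZ) /cok_pairing -raddfB /=; congr (\pi _).
  by rewrite linearB /= mulmxBr sub00.
split=> // y x z; rewrite !(psym _ y); exact: padd.
Qed.

Lemma sandpile_pairing_sym n (g : sgraph n) :
  symmetric_pairing (@sandpile_pairing n g).
Proof.
have [h1 h2 h3] := cok_pairing_sym (laplacian_sym g).
split=> [x y z|y x z|x y]; last exact: h3.
- rewrite /sandpile_pairing -h1; apply: sandpile_pairingE; first exact: extensionK.
  by apply: additive_ext => s; rewrite -{2}[y]extensionK -{2}[z]extensionK.
- rewrite /sandpile_pairing -h2; apply: sandpile_pairingE; last exact: extensionK.
  by apply: additive_ext => s; rewrite -{2}[x]extensionK -{2}[z]extensionK.
Qed.

Definition Sur_star n (g : sgraph n) (G : finZmodType)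
    (bG : dualQZ G -> dualQZ G -> QmodZ) : set {additive sandpile g -> G} :=
  [set F : {additive sandpile g -> G} |
     (forall a : G, exists s : sandpile g, F s = a) /\
     (forall u v : dualQZ G,
        sandpile_pairing (transpose F u) (transpose F v) = bG u v)]%classic.

Arguments Sur_star {n} g {G} bG.

Lemma finite_Sur_star n (g : sgraph n) (G : finZmodType) bG :
  finite_set (@Sur_star n g G bG).
Proof.
suff : finite_set [set: {additive sandpile g -> G}]%classic.
  by apply: sub_finite_set.
pose base i j : 'cV[int]_n := delta_mx i 0 - delta_mx j 0.
have hz i j : base i j \in @sum0 n.
  apply/eqP; under eq_bigr do rewrite !mxE.
  rewrite sumrB (bigD1 i) //= big1 => [|k /negPf ->//].
  by rewrite (bigD1 j) //= big1 => [|k /negPf ->//]; rewrite !eqxx.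
pose ev (F : {additive sandpile g -> G}) : {ffun 'I_n * 'I_n -> G} :=
  [ffun p => F (\pi_(sandpile g) (MkZsum0 (hz p.1 p.2)))].
have evI : injective ev.
  move=> F F' /ffunP e; apply: additive_ext => s; rewrite -[s]reprK.
  case: (repr s) => z hzz.
  have [j|n0] := pickP (fun i : 'I_n => true); last first.
    have -> : MkZsum0 hzz = 0.
      by apply: val_inj; apply/colP => i; have := n0 i.
    by rewrite !raddf0.
  move=> _; have -> : MkZsum0 hzz = \sum_i MkZsum0 (hz i j) *~ z i 0.
    apply: val_inj; transitivity (\sum_i base i j *~ z i 0); last first.
      by rewrite raddf_sum; apply: eq_bigr => i _; rewrite raddfMz.
    rewrite /= {1}[z]matrix_sum_delta.
    under [RHS]eq_bigr do rewrite /base mulrzBl.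
    rewrite sumrB -mulrz_sumr [X in _ *~ X](eqP hzz) mulr0z subr0.
    by apply: eq_bigr => i _; rewrite big_ord1 -[X in X *: _]intz scaler_int.
  rewrite !raddf_sum /=; apply: eq_bigr => i _; rewrite !raddfMz /=.
  by have := e (i, j); rewrite !ffunE /= => ->.
rewrite -(preimage_setT ev); apply: finite_preimage => [F F' _ _|]; first exact: evI.
exact: finite_finset.
Qed.

Section RandomGraph.
Variables (R : realType) (q : R) (n : nat).

Definition gnq_weight (g : sgraph n) : R :=
  \prod_(e in vpairs n) (if e \in val g then q else 1 - q).

Definition gnq_expectation (f : sgraph n -> R) : R :=
  \sum_(g : sgraph n) gnq_weight g * f g.

Lemma sum_gnq_weight : \sum_(g : sgraph n) gnq_weight g = 1.
Proof.
pose a (e : {set 'I_n}) : R := if e \in vpairs n then q else 0.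
pose b (e : {set 'I_n}) : R := if e \in vpairs n then 1 - q else 1.
transitivity (\prod_(e : {set 'I_n}) (a e + b e)); last first.
  by apply: big1 => e _; rewrite /a /b; case: ifP => _; rewrite ?subrKC ?add0r.
rewrite bigA_distr (bigID (fun E : {set {set 'I_n}} => E \subset vpairs n)) /=.
rewrite [X in _ + X]big1 ?addr0 => [|E /subsetPn[e eE /negPf eV]]; last first.
  by rewrite (bigD1 e) //= eE /a eV mul0r.
rewrite [RHS](reindex_omap (val : sgraph n -> _) insub) /=; last first.
  by move=> E hE; rewrite insubT.
apply: eq_big => [g|g _]; first by rewrite (valP g) valK eqxx.
rewrite /gnq_weight big_mkcond; apply: eq_bigr => e _; rewrite /a /b.
case: ifP => // eV; case: ifP => // eg.
by have := fintype.subsetP (valP g) _ eg; rewrite eV.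
Qed.

End RandomGraph.

(* fset_set of an infinite set is empty; Sur_star is always finite
   (finite_Sur_star), even when the sandpile group of a disconnected graph is
   infinite. *)
Definition card_Sur_star n (g : sgraph n) (G : finZmodType)
    (bG : dualQZ G -> dualQZ G -> QmodZ) : nat :=
  #|` fset_set (Sur_star g bG)|.

(* Main.v *)
(* Surjections S -> G correspond, up to the |G| choices of an extension to Z^n,
   to maps f : {1..n} -> G whose differences generate G and with f L = 0.  Split
   G as a sum of cyclic groups of orders m_k and let x_k(g) in [0, m_k) be the
   coordinates of g.  Both f L = 0 and the compatibility with the pairing are
   congruences on the integers x_k(f) L and x_k(f) L x_l(f)^t, which are detected
   by additive characters, indexed by c : {1..n} -> G for the first condition and
   by integers kappa_kl < gcd(m_k, m_l), k <= l, for the second.  The resulting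
   phase is a sum over the edges ij of -theta(t_i, t_j), where t_i = (c_i, f_i),
   so the expectation over the random graph is a product over all pairs of
   factors psi = 1 - q + q e(-theta), and |psi| < 1 unless theta is an integer,
   i.e. unless t_i and t_j are compatible.

   By Parseval a set of pairwise compatible elements of G x G has at most |G|
   elements.  In the sum over t normalised by |G|^-n only the t whose image is
   such a clique of size |G| survive as n goes to infinity.  When the f_i
   generate, these cliques are graphs of maps gamma : G -> G; they exist only for
   kappa = 0, where gamma is an alternating homomorphism plus a constant.  There
   are |G| prod_(k < l) gcd(m_k, m_l) of them, and dividing by
   |G| prod_(k <= l) gcd(m_k, m_l) leaves 1 / prod_k m_k = 1 / |G|. *)
Require Import Defs.
From HB Require Import structures.
From mathcomp Require Import all_boot all_order all_algebra all_fingroup all_solvable.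
From mathcomp Require Import generic_quotient complex finmap.
From mathcomp Require Import all_classical all_reals all_analysis.
From mathcomp Require Import ring lra zify.
Import Order.TTheory GRing.Theory Num.Theory.
Import numFieldNormedType.Exports.
Set Implicit Arguments.
Unset Strict Implicit.
Unset Printing Implicit Defensive.
Local Open Scope ring_scope.
Local Open Scope quotient_scope.

(** * Mean-field sums over maps into a finite compatibility graph *)

Section Cliques.
Variables (T : finType) (cp : rel T).

Definition clique (A : {set T}) : bool :=
  [forall s in A, forall t in A, cp s t].

Lemma cliqueP (A : {set T}) :
  reflect {in A &, forall s t, cp s t} (clique A).
Proof.
apply: (iffP forall_inP) => [h s t sA tA|h s sA]; first exact: (forall_inP (h s sA)).
by apply/forall_inP => t tA; apply: h.
Qed.

End Cliques.

Section MeanField.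
Variables (R : realType) (T : finType) (cp : rel T) (N : nat) (rho : R).
Hypotheses (rho_gt0 : 0 < rho) (rho_lt1 : rho < 1) (N_gt0 : (0 < N)%N).
Hypothesis cp_sym : symmetric cp.
Hypothesis cp_refl : reflexive cp.
Hypothesis clique_le : forall A : {set T}, clique cp A -> (#|A| <= N)%N.

(** The product runs over ordered pairs, so each unordered pair of incompatible indices contributes
    [rho ^+ 2]. *)
Definition pair_weight n (t : {ffun 'I_n -> T}) : R :=
  \prod_i \prod_j (if cp (t i) (t j) then 1 else rho).

Definition full_clique n (t : {ffun 'I_n -> T}) : bool :=
  clique cp (t @: 'I_n) && (#|t @: 'I_n| == N).

Let fiber n (t : {ffun 'I_n -> T}) s := #|[pred i | t i == s]|.

Lemma pair_factor_ge0 s s' : 0 <= (if cp s s' then 1 else rho).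
Proof. by case: ifP => // _; apply: ltW. Qed.

Lemma pair_factor_le1 s s' : (if cp s s' then 1 else rho) <= 1.
Proof. by case: ifP => // _; apply: ltW. Qed.

Lemma row_weight_le n (t : {ffun 'I_n -> T}) s s' : ~~ cp s s' ->
  \prod_j (if cp s (t j) then 1 else rho) <= rho ^+ fiber t s'.
Proof.
move=> nss; rewrite (bigID (fun j => t j == s')) /= -[leRHS]mulr1.
apply: ler_pM; try by apply: prodr_ge0 => *; exact: pair_factor_ge0.
  rewrite (eq_bigr (fun=> rho)) ?prodr_const // => j /eqP ->.
  by rewrite (negPf nss).
by apply: prodr_ile1 => j _; rewrite pair_factor_ge0 pair_factor_le1.
Qed.

Lemma row_weight_le1 n (t : {ffun 'I_n -> T}) s :
  \prod_j (if cp s (t j) then 1 else rho) <= 1.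
Proof. by apply: prodr_ile1 => j _; rewrite pair_factor_ge0 pair_factor_le1. Qed.

Lemma row_weight_ge0 n (t : {ffun 'I_n -> T}) s :
  0 <= \prod_j (if cp s (t j) then 1 else rho).
Proof. by apply: prodr_ge0 => j _; rewrite pair_factor_ge0. Qed.

Lemma pair_weight_ge0 n (t : {ffun 'I_n -> T}) : 0 <= pair_weight t.
Proof. by apply: prodr_ge0 => i _; exact: row_weight_ge0. Qed.

Lemma pair_weight_le1 n (t : {ffun 'I_n -> T}) : pair_weight t <= 1.
Proof. by apply: prodr_ile1 => i _; rewrite row_weight_ge0 row_weight_le1. Qed.

(** At least h rows have type [s], and each of them meets at least h columns of the incompatible
    type [s']. *)
Lemma pair_weight_two_big n (t : {ffun 'I_n -> T}) s s' h : ~~ cp s s' ->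
  (h <= fiber t s)%N -> (h <= fiber t s')%N ->
  pair_weight t <= rho ^+ (h * h).
Proof.
move=> nss hs hs'; rewrite /pair_weight (bigID (fun i => t i == s)) /= -[leRHS]mulr1.
apply: ler_pM; try by apply: prodr_ge0 => *; exact: row_weight_ge0.
  apply: (@le_trans _ _ (\prod_(i | t i == s) rho ^+ fiber t s')).
    apply: ler_prod => i /eqP ->; rewrite row_weight_ge0 /=; exact: row_weight_le.
  rewrite prodr_const -exprM; apply: ler_wiXn2l; rewrite ?ltW //.
  by apply: leq_mul.
by apply: prodr_ile1 => i _; rewrite row_weight_ge0 row_weight_le1.
Qed.

Let big_types n (t : {ffun 'I_n -> T}) h : {set T} :=
  finset (fun s => h <= fiber t s)%N.

Lemma notin_big_types n (t : {ffun 'I_n -> T}) h :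
  (#|[pred i | t i \notin big_types t h]| <= #|T| * h)%N.
Proof.
rewrite -sum1_card (partition_big (fun i => t i) (fun s => s \notin big_types t h)) //=.
apply: (@leq_trans (\sum_(s : T) h)); last by rewrite sum_nat_const.
rewrite [leqLHS]big_mkcond; apply: leq_sum => s _; case: ifP => // hs.
rewrite (eq_bigl (fun i => t i == s)); last first.
  by move=> i; rewrite inE; case: eqP => [->|]; rewrite ?andbF ?hs.
by rewrite sum1_card; move: hs; rewrite inE -ltnNge => /ltnW.
Qed.

(** Each index of small type will carry the factor [L^-1]. With this value the types outside a set
    add at most 1/2 to the sum over the types of one index, which is less than the gap 1 between
    clique sizes. *)
Let L : R := 2 * #|T|%:R.

(* The big types (those taken by at least h indices) either contain an
   incompatible pair, or form a clique which is too small, or form a clique of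
   size N outside of which some index lies; one summand for each case. *)
Lemma pair_weight_le_cases n (t : {ffun 'I_n -> T}) h : (0 < h)%N ->
  ~~ full_clique t -> (0 < #|T|)%N ->
  pair_weight t <= rho ^+ (h * h)
   + \sum_(B : {set T} | (#|B| < N)%N)
       L ^+ (#|T| * h) * \prod_i (if t i \in B then 1 else L^-1)
   + \sum_(B : {set T} | #|B| == N)
       (\prod_i (if t i \in B then 1 else rho ^+ h)
        - \prod_i (if t i \in B then 1 else 0)).
Proof.
move=> h_gt0 bad T_gt0.
have L_ge1 : 1 <= L.
  by rewrite /L -natrM ler1n muln_gt0.
have L_gt0 : 0 < L by apply: lt_le_trans L_ge1.
have rh_ge0 : 0 <= rho ^+ h by rewrite exprn_ge0 ?ltW.
have t2_ge0 (B : {set T}) :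
    0 <= L ^+ (#|T| * h) * \prod_i (if t i \in B then 1 else L^-1).
  rewrite mulr_ge0 ?exprn_ge0 ?(ltW L_gt0) //; apply: prodr_ge0 => i _.
  by case: ifP; rewrite ?invr_ge0 ?(ltW L_gt0).
have t3_ge0 (B : {set T}) : 0 <= \prod_i (if t i \in B then 1 else rho ^+ h)
        - \prod_i (if t i \in B then 1 else 0).
  by rewrite subr_ge0; apply: ler_prod => i _; case: ifP; rewrite ?ler01 ?lexx.
have s2_ge0 := sumr_ge0 (index_enum {set T}) (fun B (_ : (#|B| < N)%N) => t2_ge0 B).
have s3_ge0 := sumr_ge0 (index_enum {set T}) (fun B (_ : #|B| == N) => t3_ge0 B).
have r_ge0 : 0 <= rho ^+ (h * h) by rewrite exprn_ge0 ?ltW.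
set B := big_types t h.
have [cB|ncB] := boolP (clique cp B); last first.
  move: ncB; rewrite negb_forall_in => /exists_inP[s sB].
  rewrite negb_forall_in => /exists_inP[s' s'B nss].
  rewrite !inE in sB s'B.
  apply: (@le_trans _ _ (rho ^+ (h * h))); first exact: pair_weight_two_big nss sB s'B.
  by rewrite -addrA lerDl addr_ge0.
have := clique_le cB; rewrite leq_eqVlt => /orP[BN|BN].
- have [out|allin] := boolP [exists i, t i \notin B]; last first.
    case/negP: bad; have tB : t @: 'I_n = B.
      apply/setP => s; apply/imsetP/idP => [[i _ ->]|sB].
        by move: allin => /existsPn/(_ i); rewrite negbK.
      have : (0 < fiber t s)%N by apply: leq_trans h_gt0 _; rewrite inE in sB.
      by rewrite /fiber => /card_gt0P[k]; rewrite inE => /eqP <-; exists k.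
    by rewrite /full_clique tB cB.
  have z : \prod_i (if t i \in B then 1 else 0) = 0 :> R.
    case/existsP: out => i ti; rewrite (bigD1 i) //= (negPf ti) mul0r //.
  apply: (@le_trans _ _ (\prod_i (if t i \in B then 1 else rho ^+ h)
        - \prod_i (if t i \in B then 1 else 0))); last first.
    rewrite [X in _ <= _ + X](bigD1 B) //= addrCA lerDl !addr_ge0 //.
    by apply: sumr_ge0.
  rewrite z subr0; apply: ler_prod => i _; rewrite row_weight_ge0 /=.
  case: ifP => [_|/negbT tiB]; first exact: row_weight_le1.
  (* Otherwise [t i |: B] would be a clique with N + 1 elements. The type [b] fills at least h
     columns, so row i is at most [rho ^+ h]. *)
  have [b bB nb] : exists2 b, b \in B & ~~ cp (t i) b.
    apply/exists_inP; rewrite -[X in is_true X]negbK negb_exists_in; apply/negP => /forall_inP hb.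
    have : clique cp (t i |: B).
      apply/cliqueP => s s'; rewrite !inE => /predU1P[->|sB] /predU1P[->|s'B].
      - exact: cp_refl.
      - by rewrite -[cp _ _]negbK hb // /B inE.
      - by rewrite cp_sym -[cp _ _]negbK hb // /B inE.
      - by apply: (cliqueP _ _ cB); rewrite /B inE.
    by move/clique_le; rewrite cardsU1 tiB (eqP BN) ltnn.
  apply: (le_trans (row_weight_le t nb)).
  by apply: ler_wiXn2l; rewrite ?ltW //; move: bB; rewrite inE.
- apply: (le_trans (pair_weight_le1 t)).
  (* At most [#|T| * h] indices have small type, so the prefactor outweighs all their factors
     [L^-1]. *)
  apply: (@le_trans _ _ (L ^+ (#|T| * h) * \prod_i (if t i \in B then 1 else L^-1))).
    rewrite (bigID (fun i => t i \in B)) /= big1 => [|i ->//]; rewrite mul1r.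
    rewrite (eq_bigr (fun=> L^-1)); last by move=> i /negPf ->.
    rewrite prodr_const exprVn ler_pdivlMr ?exprn_gt0 // mul1r.
    by apply: ler_weXn2l => //; exact: notin_big_types.
  rewrite [X in _ <= _ + X + _](bigD1 B) //= -addrA addrCA -addrA lerDl.
  by rewrite !addr_ge0 //; apply: sumr_ge0.
Qed.

Lemma sum_prod_indicator n (B : {set T}) (a : R) :
  \sum_(t : {ffun 'I_n -> T}) \prod_i (if t i \in B then 1 else a)
  = (#|B|%:R + (#|T| - #|B|)%:R * a) ^+ n.
Proof.
rewrite -(bigA_distr_bigA (fun (i : 'I_n) s => if s \in B then 1 else a)) /=.
rewrite prodr_const card_ord; congr (_ ^+ _).
rewrite (bigID (mem B)) /= (eq_bigr (fun=> 1)) => [|s ->//].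
rewrite sumr_const [X in _ + X](eq_bigr (fun=> a)) => [|s /negPf ->//].
rewrite sumr_const -[X in _ + X]mulr_natl; congr (_ + _%:R * _).
by rewrite -(cardC B) addKn; apply: eq_card => s; rewrite !inE.
Qed.

Lemma sum_pair_weight_le n h : (0 < h)%N ->
  \sum_(t : {ffun 'I_n -> T} | ~~ full_clique t) pair_weight t <=
   #|T|%:R ^+ n * rho ^+ (h * h)
   + 2 ^+ #|T| * (L ^+ (#|T| * h) * (N%:R - 2^-1) ^+ n)
   + 2 ^+ #|T| * ((N%:R + #|T|%:R * rho ^+ h) ^+ n - N%:R ^+ n).
Proof.
move=> h_gt0.
have NR : 1 <= N%:R :> R by rewrite ler1n.
have rh_ge0 : 0 <= rho ^+ h by rewrite exprn_ge0 ?ltW.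
have L_ge0 : 0 <= L by rewrite /L mulr_ge0.
have cst (P : pred {set T}) (a : R) : 0 <= a -> \sum_(B | P B) a <= 2 ^+ #|T| * a.
  move=> a0; rewrite sumr_const -[a *+ _]mulr_natl ler_wpM2r // -natrX ler_nat.
  by rewrite -cardsT -card_powerset powersetT cardsT max_card.
(* For empty [T] the constant [L] is 0; there is then no map at all unless n = 0, where the middle
   term of the bound is 1. *)
have [T0|T_gt0] := posnP #|T|.
  have t3 : 0 <= (N%:R + 0 * rho ^+ h) ^+ n - N%:R ^+ n by rewrite mul0r addr0 subrr.
  case: n t3 => [|n] t3; last first.
    rewrite big1 => [|t _]; last by have := card0_eq T0 (t ord0); rewrite inE.
    rewrite T0; rewrite !addr_ge0 // ?mulr_ge0 ?exprn_ge0 ?(ltW rho_gt0) //; lra.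
  rewrite T0 mul0n !expr0 subrr !mulr0 !mulr1 mul1r addr0.
  apply: (@le_trans _ _ 1); last by rewrite lerDr exprn_ge0 // ltW.
  rewrite (@le_trans _ _ (\sum_(t : {ffun 'I_0 -> T}) 1)) //.
    rewrite [leLHS]big_mkcond; apply: ler_sum => t _; case: ifP => // _; exact: pair_weight_le1.
  by rewrite sumr_const card_ffun card_ord expn0.
rewrite (@le_trans _ _ (\sum_(t : {ffun 'I_n -> T}) (rho ^+ (h * h)
   + \sum_(B : {set T} | (#|B| < N)%N)
       L ^+ (#|T| * h) * \prod_i (if t i \in B then 1 else L^-1)
   + \sum_(B : {set T} | #|B| == N)
       (\prod_i (if t i \in B then 1 else rho ^+ h)
        - \prod_i (if t i \in B then 1 else 0))))) //.
  rewrite [leLHS]big_mkcond; apply: ler_sum => t _; case: ifP => [bad|_].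
    exact: pair_weight_le_cases.
  rewrite !addr_ge0 ?exprn_ge0 ?(ltW rho_gt0) //; apply: sumr_ge0 => B _.
    rewrite mulr_ge0 ?exprn_ge0 //; apply: prodr_ge0 => i _.
    by case: ifP; rewrite ?invr_ge0.
  by rewrite subr_ge0; apply: ler_prod => i _; case: ifP; rewrite ?ler01 ?lexx.
rewrite !big_split /= !lerD //.
- by rewrite sumr_const card_ffun card_ord -[_ *+ _]mulr_natl natrX.
- rewrite exchange_big /=.
  apply: le_trans (cst (fun B : {set T} => (#|B| < N)%N) _ _); last first.
    rewrite !mulr_ge0 ?exprn_ge0 //; lra.
  apply: ler_sum => B BN; rewrite -mulr_sumr sum_prod_indicator.
  rewrite ler_wpM2l ?exprn_ge0 // lerXn2r ?nnegrE; try lra.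
    by rewrite addr_ge0 // mulr_ge0 // invr_ge0.
  have h1 : (#|T| - #|B|)%:R / L <= 2^-1.
    rewrite ler_pdivrMr ?mulr_gt0 ?ltr0n // /L mulrA mulVf ?mul1r ?ler_nat ?leq_subr //.
  have h2 : #|B|%:R + 1 <= N%:R :> R by rewrite natr1 ler_nat.
  lra.
- rewrite exchange_big /=.
  apply: le_trans (cst (fun B : {set T} => #|B| == N) _ _); last first.
    rewrite subr_ge0 lerXn2r ?nnegrE ?addr_ge0 ?mulr_ge0 // lerDl mulr_ge0 //.
  apply: ler_sum => B /eqP BN; rewrite sumrB !sum_prod_indicator BN mulr0 addr0.
  rewrite lerB // lerXn2r ?nnegrE ?addr_ge0 ?mulr_ge0 //.
  by rewrite lerD2l ler_wpM2r // ler_nat leq_subr.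
Qed.

End MeanField.

(** * Elementary limits and the limit of the mean-field sum *)

Section Limits.
Local Open Scope classical_set_scope.

Lemma bernoulli_le (R : realDomainType) (x : R) n : 0 <= x ->
  1 + n%:R * x <= (1 + x) ^+ n.
Proof.
move=> x0; elim: n => [|n IH]; first by rewrite mul0r addr0 expr0.
rewrite exprS; apply: le_trans (ler_wpM2l _ IH); last by rewrite addr_ge0.
rewrite -natr1; have : 0 <= n%:R * x * x by rewrite !mulr_ge0.
nra.
Qed.

(** Counterpart of Bernoulli from above: while 2ny is at most 1, the second-order term
    [2 * n%:R * y * y] stays below y, so each factor adds at most 2y. *)
Lemma expr1D_le (R : realDomainType) (y : R) n : 0 <= y -> 2 * n%:R * y <= 1 ->
  (1 + y) ^+ n <= 1 + 2 * n%:R * y.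
Proof.
move=> y0; elim: n => [|n IH]; first by rewrite expr0 mulr0 mul0r addr0.
rewrite -natr1 exprS => hn.
have hn' : 2 * n%:R * y <= 1 by nra.
apply: le_trans (ler_wpM2l _ (IH hn')) _; first by rewrite addr_ge0.
have : 2 * n%:R * y * y <= y by rewrite ler_piMl.
nra.
Qed.

Lemma cvg_geometric0 (R : realType) (a z : R) : 0 < z -> z < 1 ->
  a * z ^+ n @[n --> \oo] --> 0.
Proof. by move=> z0 z1; apply: cvg_geometric; rewrite ger0_norm ?ltW. Qed.

Lemma cvg_succ_geometric (R : realType) (r : R) : 0 < r -> r < 1 ->
  h.+1%:R * r ^+ h @[h --> \oo] --> 0.
Proof.
move=> r0 r1; set s := Num.sqrt r.
have s0 : 0 < s by rewrite sqrtr_gt0.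
have s1 : s < 1 by rewrite -sqrtr1 ltr_sqrt.
(* Half of the decay is set aside: by Bernoulli for [s^-1 = 1 + x], one factor [s ^+ h] absorbs
   [h.+1], and the other still tends to 0. *)
have rE : r = s * s by rewrite -expr2 sqr_sqrtr ?ltW.
pose x := s^-1 - 1.
have x0 : 0 < x by rewrite subr_gt0 invf_gt1.
have sx : s^-1 = 1 + x by rewrite /x addrC subrK.
apply: (@squeeze_cvgr _ _ _ _ (cst 0) (fun h => (1 + x^-1) * s ^+ h)).
- near=> h; apply/andP; split; first by rewrite mulr_ge0 ?exprn_ge0 ?ltW.
  rewrite [in leLHS]rE exprMn mulrA.
  rewrite ler_wpM2r ?exprn_ge0 ?(ltW s0) //.
  rewrite -ler_pdivlMr ?exprn_gt0 // -exprVn sx.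
  apply: le_trans (ler_wpM2l _ (bernoulli_le h (ltW x0))); last first.
    by rewrite addr_ge0 // invr_ge0 ltW.
  have -> : (1 + x^-1) * (1 + h%:R * x) = 1 + h%:R * x + x^-1 + h%:R * (x^-1 * x) by ring.
  rewrite mulVf ?gt_eqF // mulr1 -natr1.
  have : 0 <= h%:R * x by rewrite mulr_ge0 // ltW.
  have : 0 < x^-1 by rewrite invr_gt0.
  lra.
- exact: cvg_cst.
- exact: cvg_geometric0.
Unshelve. all: by end_near. Qed.

Lemma cvg_divn K : (0 < K)%N -> (n %/ K)%N @[n --> \oo] --> \oo.
Proof.
move=> K0; apply/cvgnyPge => A; exists (A * K)%N => //= n /=.
by rewrite -leq_divRL.
Qed.

Section MeanFieldLimit.
Variables (R : realType) (T : finType) (cp : rel T) (N : nat) (rho : R).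
Hypotheses (rho_gt0 : 0 < rho) (rho_lt1 : rho < 1) (N_gt0 : (0 < N)%N).
Hypothesis cp_sym : symmetric cp.
Hypothesis cp_refl : reflexive cp.
Hypothesis clique_le : forall A : {set T}, clique cp A -> (#|A| <= N)%N.

(* The threshold for big types is n %/ K, with K so large that the entropy of the
   indices of small type does not compensate the factor (1 - 1/(2N))^n. *)
Lemma mean_field :
  N%:R ^- n * (\sum_(t : {ffun 'I_n -> T} | ~~ full_clique cp N t)
     pair_weight cp rho t) @[n --> \oo] --> (0 : R).
Proof.
have NR : 1 <= N%:R :> R by rewrite ler1n.
have NR0 : 0 < N%:R :> R by rewrite ltr0n.
pose A : R := #|T|.+1%:R; pose L : R := 2 * #|T|%:R; pose b : R := (N%:R - 2^-1) / N%:R.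
have A1 : 1 <= A by rewrite ler1n.
have L0 : 0 <= L by rewrite mulr_ge0.
have b0 : 0 < b by rewrite divr_gt0 //; lra.
have b1 : b < 1 by rewrite ltr_pdivrMr //; lra.
have [K K0 LK] : exists2 K, (0 < K)%N & L ^+ #|T| * b ^+ K <= 2^-1.
  have := cvg_geometric0 (L ^+ #|T|) b0 b1.
  move=> /cvgr0Pnorm_le/(_ 2^-1 ltac:(by rewrite invr_gt0)) [K _ hK]; exists K.+1 => //.
  have := hK K.+1 (leqnSn _) => /=.
  by rewrite ger0_norm // mulr_ge0 ?exprn_ge0 ?(ltW b0).
(* [z h] dominates n times the relative increment in the third summand; [D h] collects the bounds of
   the three summands. *)
pose z h := K%:R * A * (h.+1%:R * rho ^+ h).
pose D h := (A ^+ K + 2 ^+ #|T|) * 2^-1 ^+ h + 2 ^+ #|T| * (2 * z h).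
have z_cvg : z h @[h --> \oo] --> 0.
  rewrite -[X in _ --> X](mulr0 (K%:R * A)); apply: cvgMr => //; exact: cvg_succ_geometric.
have D_cvg : D h @[h --> \oo] --> 0.
  rewrite -[X in _ --> X]addr0; apply: cvgD.
    by apply: cvg_geometric0; rewrite ?invr_gt0 ?invf_lt1 ?ltr1n.
  rewrite -[X in _ --> X](mulr0 (2 ^+ #|T|)); apply: cvgMr => //.
  by rewrite -[X in _ --> X](mulr0 2); apply: cvgMr.
(* From here on [rho ^+ (h * h)] beats the normalised number of maps, which is at most [A ^+ n],
   hence at most [A ^+ (K * h.+1)]. *)
have ev1 : \forall h \near \oo, A ^+ K * rho ^+ h <= 2^-1.
  have := cvg_geometric0 (A ^+ K) rho_gt0 rho_lt1.
  move=> /cvgr0Pnorm_le/(_ 2^-1 ltac:(by rewrite invr_gt0)).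
  by apply: filterS => h; apply: le_trans; rewrite ler_norm.
(* This is the range in which [expr1D_le] applies. *)
have ev2 : \forall h \near \oo, z h <= 2^-1.
  move: z_cvg => /cvgr0Pnorm_le/(_ 2^-1 ltac:(by rewrite invr_gt0)).
  by apply: filterS => h; apply: le_trans; rewrite ler_norm.
have ev3 : \forall h \near \oo, (0 < h)%N by exists 1%N.
have ev := cvg_divn K0 (filterI ev1 (filterI ev2 ev3)).
apply: (@squeeze_cvgr _ _ _ _ (cst 0) (fun n => D (n %/ K)%N)); last 2 first.
- exact: cvg_cst.
- by apply: (@cvg_comp _ _ _ (fun n => n %/ K)%N D); [exact: (cvg_divn K0)|exact: D_cvg].
near=> n.
have [h1 [h2 h0]] : A ^+ K * rho ^+ (n %/ K) <= 2^-1 /\ z (n %/ K)%N <= 2^-1 /\ (0 < n %/ K)%N.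
  by near: n; exact: ev.
apply/andP; split.
  rewrite /= mulr_ge0 ?invr_ge0 ?exprn_ge0 //; apply: sumr_ge0 => t _.
  exact: pair_weight_ge0.
have := sum_pair_weight_le rho_gt0 rho_lt1 N_gt0 cp_sym cp_refl clique_le n h0.
set h := (n %/ K)%N in h1 h2 h0 *.
have nK1 : (K * h <= n)%N by rewrite mulnC leq_trunc_div.
have nK2 : (n <= K * h.+1)%N by rewrite mulnC ltnW // ltn_ceil.
have Nn : 0 < N%:R ^+ n :> R by rewrite exprn_gt0.
rewrite -(ler_pM2l (x := N%:R ^- n)) ?invr_gt0 // => /le_trans; apply.
rewrite [leLHS]mulrDr [X in X + _ <= _]mulrDr /D [in leRHS]mulrDl.
apply: lerD; first apply: lerD.
- rewrite mulrA -exprVn -exprMn.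
  apply: (@le_trans _ _ (A ^+ (K * h.+1) * rho ^+ (h * h))).
    rewrite ler_wpM2r ?exprn_ge0 ?(ltW rho_gt0) //.
    apply: (@le_trans _ _ (A ^+ n)); last exact: ler_weXn2l.
    rewrite lerXn2r ?nnegrE ?mulr_ge0 ?invr_ge0 //.
    apply: (@le_trans _ _ #|T|%:R); last by rewrite ler_nat.
    by rewrite ler_piMl // invf_le1.
  rewrite mulnS exprD -mulrA ler_wpM2l ?exprn_ge0 // !exprM -exprMn.
  by rewrite lerXn2r ?nnegrE ?mulr_ge0 ?exprn_ge0 // ltW.
- rewrite mulrCA ler_wpM2l ?exprn_ge0 //.
  rewrite mulrCA -exprVn -exprMn [_^-1 * _]mulrC -/b exprM.
  apply: (@le_trans _ _ ((L ^+ #|T|) ^+ h * (b ^+ K) ^+ h)).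
    rewrite ler_wpM2l ?exprn_ge0 // -exprM.
    by apply: ler_wiXn2l; rewrite ?ltW.
  by rewrite -exprMn lerXn2r ?nnegrE ?mulr_ge0 ?exprn_ge0 ?(ltW b0).
- rewrite mulrCA ler_wpM2l ?exprn_ge0 //.
  rewrite mulrBr mulVf ?gt_eqF // -exprVn -exprMn mulrDr mulVf ?gt_eqF //.
  set y := N%:R^-1 * _.
  have y0 : 0 <= y by rewrite !mulr_ge0 ?invr_ge0 ?exprn_ge0 // ltW.
  have yA : y <= A * rho ^+ h.
    rewrite /y mulrA ler_wpM2r ?exprn_ge0 ?(ltW rho_gt0) //.
    apply: (@le_trans _ _ #|T|%:R); last by rewrite ler_nat.
    by rewrite ler_piMl // invf_le1.
  have nyz : n%:R * y <= z h.
    apply: (@le_trans _ _ ((K * h.+1)%:R * (A * rho ^+ h))).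
      by apply: ler_pM => //; rewrite ler_nat.
    by rewrite /z natrM le_eqVlt; apply/orP; left; apply/eqP; ring.
  have := @expr1D_le _ y n y0; lra.
Unshelve. all: by end_near. Qed.

End MeanFieldLimit.

End Limits.

(** * The unit character *)

Section UnitCharacter.
Variable R : realType.
Implicit Types a b y : rat.

(** The additive character e(a) = exp(2 pi i a). *)
Definition ec a : R[i] := (cos (2 * pi * ratr a) +i* sin (2 * pi * ratr a))%C.

Lemma ecD a b : ec (a + b) = ec a * ec b.
Proof.
rewrite /ec rmorphD /= mulrDr cosD sinD; apply/eqP; rewrite eq_complex /=.
by rewrite eqxx /= addrC; apply/eqP; ring.
Qed.

Lemma ec0 : ec 0 = 1.
Proof. by rewrite /ec rmorph0 mulr0 cos0 sin0. Qed.

Lemma ecMn a k : ec (a *+ k) = ec a ^+ k.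
Proof. by elim: k => [|k IH]; rewrite ?ec0 // mulrS ecD IH exprS. Qed.

Lemma ec_conj a : (ec a)^* = ec (- a).
Proof. by rewrite /ec rmorphN /= mulrN cosN sinN. Qed.

Lemma ecNK a : ec a * ec (- a) = 1.
Proof. by rewrite -ecD subrr ec0. Qed.

Lemma norm_ec a : `|ec a| = 1.
Proof. by apply/eqP; rewrite -sqrp_eq1 // normCK ec_conj ecNK. Qed.

Lemma ec_int a : a \is a Num.int -> ec a = 1.
Proof.
have e1 : ec 1 = 1.
  by rewrite /ec rmorph1 mulr1 mulr_natl cos2pi sin2pi.
have enat k : ec k%:R = 1 by rewrite ecMn e1 expr1n.
move=> /intrP[[k|k] ->]; first exact: enat.
by rewrite NegzE mulrNz -[LHS]mul1r -[in LHS](enat k.+1) ecNK.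
Qed.

Lemma ec_sum (I : Type) (r : seq I) (P : pred I) (F : I -> rat) :
  ec (\sum_(i <- r | P i) F i) = \prod_(i <- r | P i) ec (F i).
Proof. exact: (big_morph _ ecD ec0). Qed.

Lemma cos2pi_eq1 a : cos (2 * pi * ratr a) = 1 :> R -> a \is a Num.int.
Proof.
(* Pass to the fractional part x. If it is positive then 0 < pi x < pi, and cos(2 pi x) = 1 - 2
   sin(pi x)^2 is less than 1. *)
move=> c1; rewrite intrEfloor; set f := Num.floor a.
have c2 : cos (2 * pi * ratr (a - f%:~R)) = 1 :> R.
  have := congr1 (@complex.Re R) (ecD a (- f%:~R)).
  by rewrite [ec (- _)]ec_int ?rpredN ?intr_int // mulr1 /= c1.
have a0 : 0 <= a - f%:~R by rewrite subr_ge0 floor_le.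
have a1 : a - f%:~R < 1 by rewrite ltrBlDl; have := floorD1_gt a; rewrite rmorphD.
move: a0; rewrite le_eqVlt => /orP[|a0].
  by rewrite eq_sym subr_eq0 eq_sym.
set x : R := ratr (a - f%:~R) in c2.
have x0 : 0 < x by rewrite ltr0q.
have x1 : x < 1 by rewrite -[1](rmorph1 (@ratr R)) ltr_rat.
have s0 : 0 < sin (pi * x).
  by apply: sin_gt0_pi; rewrite mulr_gt0 ?pi_gt0 //= gtr_pMr ?pi_gt0.
have : cos (2 * pi * x) = 1 - 2 * sin (pi * x) ^+ 2.
  have -> : 2 * pi * x = pi * x + pi * x by ring.
  by rewrite cosD -!expr2; have := cos2Dsin2 (pi * x); lra.
rewrite c2 => h; have : 0 < sin (pi * x) ^+ 2 by rewrite exprn_gt0.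
lra.
Qed.

Lemma ec_eq1 a : (ec a == 1) = (a \is a Num.int).
Proof.
apply/eqP/idP => [/(congr1 (@complex.Re R))|/ec_int //].
by rewrite /ec /=; exact: cos2pi_eq1.
Qed.

Lemma sum_ec (g : nat) y : g%:R * y \is a Num.int ->
  \sum_(k < g) ec (k%:R * y) = if y \is a Num.int then g%:R else 0.
Proof.
move=> gy; case: ifPn => yi.
  rewrite (eq_bigr (fun=> 1)) ?sumr_const ?card_ord // => k _.
  by rewrite ec_int // rpredM ?rpred_nat.
(* Geometric sum: the product telescopes to [ec (g%:R * y) - 1], which vanishes. *)
have : (ec y - 1) * \sum_(k < g) ec (k%:R * y) = 0.
  rewrite (eq_bigr (fun k : 'I_g => ec y ^+ k)) => [|k _]; last by rewrite mulr_natl ecMn.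
  by rewrite -subrX1 -ecMn -mulr_natl ec_int // subrr.
by move/eqP; rewrite mulf_eq0 subr_eq0 ec_eq1 (negPf yi) => /eqP.
Qed.

(** Expectation of the contribution of one edge: e(a) if the edge is present, 1 otherwise. *)
Definition psi (q : R) a : R[i] := (1 - q)%:C%C + q%:C%C * ec a.

Lemma psi_int q a : a \is a Num.int -> psi q a = 1.
Proof. by move=> ai; rewrite /psi ec_int // mulr1 -rmorphD subrK rmorph1. Qed.

Lemma norm_psi_lt1 q a : 0 < q -> q < 1 -> a \isn't a Num.int ->
  exists2 r : R, r < 1 & `|psi q a| = r%:C%C.
Proof.
move=> q0 q1 an; eexists; last exact: normc_def.
rewrite /psi /ec /= !mul0r !subr0 ?addr0 !add0r.
set c := cos _; set s := sin _.
have cs : c ^+ 2 + s ^+ 2 = 1 := cos2Dsin2 _.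
have c1 : c < 1.
  rewrite lt_neqAle cos_le1 andbT; apply: contra an => /eqP; exact: cos2pi_eq1.
rewrite -[ltRHS]sqrtr1 ltr_sqrt //.
(* The squared modulus of [psi q a] equals 1 - 2q(1 - q)(1 - c). *)
have : 0 < q * (1 - q) * (1 - c) by rewrite !mulr_gt0 // subr_gt0.
nra.
Qed.

End UnitCharacter.

(** The bound is a square because [pair_weight] counts every unordered pair twice. *)
Lemma finite_lt1_bound (R : rcfType) (I : finType) (P : pred I) (F : I -> R) :
  (forall i, P i -> F i < 1) ->
  exists rho, [/\ 0 < rho, rho < 1 & forall i, P i -> F i <= rho ^+ 2].
Proof.
move=> F1.
have [m [m0 m1 Fm]] : exists m, [/\ 0 < m, m < 1 & forall i, P i -> F i <= m].
  (* Starting the maximum at 1/2 keeps it positive whatever the values. *)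
  pose m := \big[Num.max/2^-1]_(i | P i) F i.
  have half : 0 < 2^-1 :> R /\ 2^-1 < 1 :> R by split; lra.
  exists m; split.
  - by apply: lt_le_trans half.1 _; rewrite /m; elim/big_rec: _ => // i x _ h; rewrite le_max h orbT.
  - by rewrite /m; elim/big_ind: _ => [|x y hx hy|]; [exact: half.2|rewrite gt_max hx|].
  - by move=> i Pi; rewrite /m (bigD1 i) //= le_max lexx.
exists (Num.sqrt m); rewrite sqrtr_gt0 m0 -sqrtr1 ltr_sqrt // m1; split=> // i Pi.
by rewrite sqr_sqrtr ?Fm ?ltW.
Qed.

(** * Coordinates on a finite abelian group *)

(** A decomposition of [G] into cyclic groups of orders m_k, with coordinates chosen in [0, m_k).
    Trivial factors m_k = 1 are allowed; they are treated apart where a basis element then has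
    coordinate 0 instead of 1. *)
Record cyclic_coords (G : finZmodType) := CyclicCoords {
  crank : nat;
  cord : 'I_crank -> nat;
  cbasis : 'I_crank -> G;
  coord : G -> 'I_crank -> nat;
  cord_gt0 : forall k, (0 < cord k)%N;
  coord_lt : forall g k, (coord g k < cord k)%N;
  coord_sum : forall g, g = \sum_k cbasis k *+ coord g k;
  coord_uniq : forall g (y : 'I_crank -> nat), (forall k, y k < cord k)%N ->
    g = \sum_k cbasis k *+ y k -> forall k, y k = coord g k;
  cbasis_ord : forall k, cbasis k *+ cord k = 0 }.

Lemma cyclic_coords_exist (G : finZmodType) : inhabited (cyclic_coords G).
Proof.
have [b db _] := abelian_structure (FinRing.zmod_abelian [group of [set: G]]).
have mulgsum (I : finType) (F : I -> G) : (\prod_i F i)%g = \sum_i F i.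
  by apply: (big_ind2 (fun a b => a = b)) => // x1 x2 y1 y2 -> ->.
rewrite big_tnth in db; set e := tnth _ in db.
have ex (g : G) : exists y : 'I_(size b) -> nat, [/\ forall k, (y k < #[e k]%g)%N,
    g = \sum_k e k *+ y k &
    forall y' : 'I_(size b) -> nat, (forall k, y' k < #[e k]%g)%N ->
      g = \sum_k e k *+ y' k -> forall k, y' k = y k].
  have gT : g \in [group of [set: G]] by rewrite inE.
  have [c [c1 c2 c3]] := mem_bigdprod db gT.
  have ck k : exists2 a, (a < #[e k]%g)%N & c k = e k *+ a.
    by have /cyclePmin[a a1 ->] := c1 k isT; exists a; rewrite // FinRing.zmodXgE.
  have [y yP] := boolp.choice (fun k => let: ex_intro2 a h1 h2 := ck k in
     ex_intro (fun a => (a < #[e k]%g)%N /\ c k = e k *+ a) a (conj h1 h2)).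
  exists y; split=> [k||y' y'lt gy' k]; first by case: (yP k).
    by rewrite c2 mulgsum; apply: eq_bigr => k _; case: (yP k).
  have := c3 (fun k => e k *+ y' k); rewrite mulgsum => /(_ _ gy' k isT).
  have [ylt ->] := yP k; rewrite -!FinRing.zmodXgE => h.
  have /eqP := h ltac:(by move=> j _; rewrite /= -FinRing.zmodXgE mem_cycle).
  by rewrite eq_expg_mod_order !modn_small // => /eqP.
have [x xP] := boolp.choice ex; constructor.
apply: (@CyclicCoords G (size b) (fun k => #[e k]%g) e x) => [k|g k|g|g y|k].
- exact: order_gt0.
- by case: (xP g).
- by case: (xP g).
- by case: (xP g) => _ _; apply.
- by rewrite -FinRing.zmodXgE expg_order.
Qed.

Section Coordinates.
Variables (G : finZmodType) (S : cyclic_coords G).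
Local Notation r := (crank S).
Local Notation m := (@cord G S).
Local Notation e := (@cbasis G S).
Local Notation x := (@coord G S).
Implicit Types (g h c f : G) (k l : 'I_r).

Lemma cord_neq0 k : (m k)%:R != 0 :> rat.
Proof. by rewrite pnatr_eq0 -lt0n cord_gt0. Qed.

Lemma cbasis_mod k a : e k *+ (a %% m k) = e k *+ a.
Proof. by rewrite [in RHS](divn_eq a (m k)) mulrnDr mulnC mulrnA cbasis_ord mul0rn add0r. Qed.

Lemma coord_sum_mod (y : 'I_r -> nat) k : x (\sum_l e l *+ y l) k = (y k %% m k)%N.
Proof.
apply/esym; apply: (@coord_uniq G S _ (fun k => (y k %% m k)%N)) => [l|].
  by rewrite ltn_mod cord_gt0.
by apply: eq_bigr => l _; rewrite cbasis_mod.
Qed.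

Lemma coord0 k : x 0 k = 0%N.
Proof.
have := coord_sum_mod (fun=> 0%N) k; rewrite mod0n => <-.
by rewrite big1 // => l _; rewrite mulr0n.
Qed.

Lemma coordD g h k : x (g + h) k = ((x g k + x h k) %% m k)%N.
Proof.
rewrite -(coord_sum_mod (fun l => (x g l + x h l)%N)); congr (x _ _).
rewrite {1}(coord_sum S g) {1}(coord_sum S h) -big_split /=.
by apply: eq_bigr => l _; rewrite mulrnDr.
Qed.

Lemma coord_basis k l : x (e k) l = ((k == l) %% m l)%N.
Proof.
rewrite -(coord_sum_mod (fun l => (k == l) : nat)); congr (x _ _).
rewrite (bigD1 k) //= eqxx mulr1n big1 ?addr0 // => j.
by rewrite eq_sym => /negPf ->; rewrite mulr0n.
Qed.

Lemma coord_inj g h : (forall k, x g k = x h k) -> g = h.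
Proof.
move=> gh; rewrite (coord_sum S g) (coord_sum S h).
by apply: eq_bigr => k _; rewrite gh.
Qed.

Lemma coordD_int g h k :
  ((x (g + h) k)%:R - (x g k)%:R - (x h k)%:R) / (m k)%:R \is a @Num.int rat.
Proof.
rewrite coordD [X in _ \in X]/=.
have /(congr1 (fun a => a%:R : rat)) := divn_eq (x g k + x h k) (m k).
rewrite !natrD natrM => h1.
set a := (_ %% _)%N in h1 *; set q := (_ %/ _)%N in h1.
have -> : a%:R - (x g k)%:R - (x h k)%:R = - (q%:R * (m k)%:R) :> rat.
  have <- : (x g k)%:R + (x h k)%:R - a%:R = q%:R * (m k)%:R :> rat by rewrite h1 addrK.
  ring.
by rewrite mulNr mulfK ?cord_neq0 // rpredN rpred_nat.
Qed.

(** The character x_k/m_k modulo Z; together these characters generate the dual group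
    ([dual_basis_span]). *)
Definition dual_basis_fun k g : QmodZ := \pi_QmodZ ((x g k)%:R / (m k)%:R).

Fact dual_basis_is_additive k : zmod_morphism (dual_basis_fun k).
Proof.
move=> g h; have := coordD_int (g - h) h k; rewrite subrK => hi.
rewrite /dual_basis_fun -raddfB; apply/piQZ_eq; rewrite -rpredN.
by congr (_ \is a Num.int): hi; ring.
Qed.

HB.instance Definition _ k :=
  GRing.isZmodMorphism.Build G QmodZ (dual_basis_fun k) (dual_basis_is_additive k).

Definition dual_basis k : dualQZ G := dual_basis_fun k.

Lemma dual_basisE k g : dual_basis k g = \pi_QmodZ ((x g k)%:R / (m k)%:R).
Proof. by []. Qed.

Lemma natr_div_int (a d : nat) : (0 < d)%N ->
  (a%:R / d%:R \is a @Num.int rat) = (d %| a)%N.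
Proof.
move=> d0; have dn0 : d%:R != 0 :> rat by rewrite pnatr_eq0 -lt0n.
apply/idP/idP => [/intrP[z hz]|/dvdnP[b ->]]; last first.
  by rewrite natrM mulfK // rpred_nat.
have : a%:R = z%:~R * d%:R :> rat by rewrite -hz divfK.
rewrite !pmulrn -intrM => /eqP; rewrite eqr_int => /eqP h.
by have : (d%:Z %| a%:Z)%Z by rewrite h dvdz_mull.
Qed.

Lemma dual_basis_eq0 g : (forall k, dual_basis k g = 0) -> g = 0.
Proof.
move=> g0; apply: coord_inj => k; rewrite coord0.
have := g0 k; rewrite dual_basisE => /piQZ_eq0; rewrite natr_div_int ?cord_gt0 //.
move=> /dvdnP[[|b]]; first by rewrite mul0n.
by have := coord_lt g k; rewrite mulSn => + h; rewrite h -ltn_subRL subnn ltn0.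
Qed.

(** Coordinates identify [G] with a product of ranges [0, m_k), over which a sum of products
    distributes. The type ['I_M.+1] is large enough to hold all these ranges at once. *)
Lemma big_coord (R : comNzRingType) (F : 'I_r -> nat -> R) :
  \sum_(g : G) \prod_k F k (x g k) = \prod_k \sum_(a < m k) F k a.
Proof.
pose M := (\sum_k m k)%N.
have mM k : (m k <= M)%N by rewrite /M (bigD1 k) //= leq_addr.
have lM k a : (a < m k)%N -> (a < M.+1)%N by move=> h; rewrite ltnS ltnW // (leq_trans h).
under [RHS]eq_bigr => k _ do rewrite (big_ord_widen M.+1 _ (leqW (mM k))).
rewrite bigA_distr_big_dep /=.
pose h (f : {ffun 'I_r -> 'I_M.+1}) : G := \sum_k e k *+ f k.
rewrite [LHS](reindex_onto h (fun g => [ffun k => inord (x g k)])) /=; last first.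
  move=> g _; rewrite /h [RHS](coord_sum S g); apply: eq_bigr => k _.
  by rewrite ffunE inordK // (lM k) // coord_lt.
apply: eq_big => [f|f /eqP ff]; last first.
  by apply: eq_bigr => k _; rewrite -{2}ff ffunE inordK // (lM k) // coord_lt.
apply/eqP/familyP => [ff k|ff].
  by rewrite -ff ffunE unfold_in /= inordK ?(lM k) // coord_lt.
apply/ffunP => k; rewrite ffunE; apply: val_inj => /=.
have fk : (f k < m k)%N by have := ff k; rewrite unfold_in.
by rewrite /h coord_sum_mod modn_small // inordK // (lM k).
Qed.

Lemma card_prod_cord : #|G| = (\prod_k m k)%N.
Proof.
apply/eqP; rewrite -(eqr_nat int) -sum1_card.
have := big_coord (fun _ _ => 1%:Z); rewrite natr_prod natr_sum.
under [X in X = _ -> _]eq_bigr do rewrite big1 //.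
by move=> ->; apply/eqP; apply: eq_bigr => k _; rewrite sumr_const card_ord.
Qed.

(** Orthogonality of characters of [G], one cyclic factor at a time. *)
Lemma sum_ec_coord (R : realType) (y : 'I_r -> int) :
  \sum_(g : G) ec R (\sum_k (x g k)%:R * ((y k)%:~R / (m k)%:R)) =
  if [forall k, (y k)%:~R / (m k)%:R \is a @Num.int rat] then #|G|%:R else 0.
Proof.
under eq_bigr do rewrite ec_sum.
rewrite (big_coord (fun k a => ec R (a%:R * ((y k)%:~R / (m k)%:R)))).
under eq_bigr => k _.
  rewrite sum_ec; last by rewrite mulrCA divff ?cord_neq0 // mulr1 intr_int.
  over.
case: ifPn => [/forallP yi|]; last first.
  by rewrite negb_forall => /existsP[k /negPf yk]; rewrite (bigD1 k) //= yk mul0r.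
by rewrite card_prod_cord natr_prod; apply: eq_bigr => k _; rewrite yi.
Qed.

End Coordinates.

(** * Compatibility cliques *)

Lemma natr_eq_mod (a b d : nat) : (a < d)%N -> (b < d)%N ->
  (a%:R - b%:R) / d%:R \is a @Num.int rat -> a = b.
Proof.
move=> ad bd /intrP[z hz].
have d0 : d%:R != 0 :> rat by rewrite pnatr_eq0 -lt0n (leq_ltn_trans _ ad).
have /eqP : a%:R - b%:R = z%:~R * d%:R :> rat by rewrite -hz divfK.
rewrite !pmulrn -rmorphB -intrM eqr_int => /eqP h.
have : z = 0 by nia.
by move=> z0; move: h; rewrite z0 mul0r => h; lia.
Qed.

Section PhaseCliques.
Variables (G : finZmodType) (S : cyclic_coords G).
Local Notation r := (crank S).
Local Notation m := (@cord G S).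
Local Notation e := (@cbasis G S).
Local Notation x := (@coord G S).
Implicit Types (g h c f : G) (k l : 'I_r) (s t : G * G) (kappa : 'I_r * 'I_r -> nat).

Definition X g k : rat := (x g k)%:R.

Lemma X_int g k : X g k \is a Num.int. Proof. exact: rpred_nat. Qed.

Definition coord_prod c c' f f' : rat :=
  \sum_k (X c k - X c' k) * (X f k - X f' k) / (m k)%:R.

Definition quad_part kappa f f' : rat :=
  \sum_p (kappa p)%:R * (X f p.1 - X f' p.1) * (X f p.2 - X f' p.2)
          / ((m p.1)%:R * (m p.2)%:R).

(** Up to sign, the phase that an edge acquires when its ends carry the labels s and t of the form
    (c, f): the first summand comes from the condition f L = 0, the second from the pairing. *)
Definition theta kappa s t : rat :=
  coord_prod s.1 t.1 s.2 t.2 + quad_part kappa s.2 t.2.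

Definition compat kappa : rel (G * G) := fun s t => theta kappa s t \is a Num.int.

Lemma theta_sym kappa s t : theta kappa s t = theta kappa t s.
Proof.
by rewrite /theta; congr (_ + _); apply: eq_bigr => k _; ring.
Qed.

Lemma theta_refl kappa s : theta kappa s s = 0.
Proof.
by rewrite /theta /coord_prod /quad_part !big1 ?addr0 // => k _; rewrite !subrr !(mul0r, mulr0).
Qed.

Lemma compat_sym kappa : symmetric (compat kappa).
Proof. by move=> s t; rewrite /compat theta_sym. Qed.

Lemma compat_refl kappa : reflexive (compat kappa).
Proof. by move=> s; rewrite /compat theta_refl rpred0. Qed.

Lemma coord_prodB c c' f f' f'' :
  coord_prod c c' f f' - coord_prod c c' f f'' = coord_prod c c' f'' f'.
Proof. by rewrite /coord_prod -sumrB; apply: eq_bigr => k _; ring. Qed.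

(** * Sizes of cliques by Parseval *)

Section Parseval.
Variable R : realType.

(** Let [Z h] be the sum over c in C of the characters of c at h - f0. By orthogonality the total of
    |Z(h)|^2 over [G] is |C||G|; on D every term of the expansion is 1, so D alone contributes
    |D||C|^2. *)
Lemma parseval_card (C D : {set G}) :
  {in C &, forall c c', {in D &, forall f f', coord_prod c c' f f' \is a Num.int}} ->
  (#|C| * #|D| <= #|G|)%N.
Proof.
move=> CD; have [->|[f0 f0D]] := set_0Vmem D; first by rewrite cards0 muln0.
have [->|[c0 c0C]] := set_0Vmem C; first by rewrite cards0.
pose a c h : rat := \sum_k X c k * (X h k - X f0 k) / (m k)%:R.
have aB c c' h : a c h - a c' h = coord_prod c c' h f0.
  by rewrite /a /coord_prod -sumrB; apply: eq_bigr => k _; ring.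
pose Z h := \sum_(c in C) ec R (a c h).
have ZZ h : Z h * (Z h)^* = \sum_(c in C) \sum_(c' in C) ec R (a c h - a c' h).
  rewrite /Z rmorph_sum mulr_suml; apply: eq_bigr => c _.
  by rewrite mulr_sumr; apply: eq_bigr => c' _; rewrite /= ec_conj ecD.
have total : \sum_h Z h * (Z h)^* = (#|C| * #|G|)%:R.
  under eq_bigr do rewrite ZZ.
  rewrite exchange_big /= natrM mulr_natl -sumr_const; apply: eq_bigr => c cC.
  rewrite exchange_big /= (bigD1 c) //= [X in _ + X]big1 ?addr0 => [|c' /andP[c'C cc']].
    by under eq_bigr do rewrite subrr ec0; rewrite sumr_const.
  pose y k : int := (x c k)%:Z - (x c' k)%:Z.
  pose const := \sum_k (y k)%:~R * X f0 k / (m k)%:R : rat.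
  have aE h : a c h - a c' h = \sum_k (x h k)%:R * ((y k)%:~R / (m k)%:R) + - const.
    rewrite aB /coord_prod /const -sumrB; apply: eq_bigr => k _.
    rewrite /y rmorphB /= -!pmulrn -/(X c k) -/(X c' k) -/(X h k); ring.
  under eq_bigr do rewrite aE ecD.
  rewrite -mulr_suml sum_ec_coord; case: ifP => [/forallP yi|_]; last by rewrite mul0r.
  case/eqP: cc'; apply/esym/(@coord_inj _ S) => k.
  have := yi k; rewrite /y => hk.
  apply: (@natr_eq_mod _ _ (m k)); rewrite ?coord_lt //.
  by move: hk; rewrite rmorphB /= -!pmulrn.
have low : \sum_(h in D) Z h * (Z h)^* = (#|D| * (#|C| * #|C|))%:R.
  rewrite natrM mulr_natl -sumr_const; apply: eq_bigr => h hD.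
  rewrite ZZ natrM mulr_natl -sumr_const; apply: eq_bigr => c cC.
  rewrite -sumr_const; apply: eq_bigr => c' c'C.
  by rewrite aB ec_int // CD.
have : (#|D| * (#|C| * #|C|))%:R <= (#|C| * #|G|)%:R :> R[i].
  rewrite -low -total big_mkcond; apply: ler_sum => h _.
  by case: ifP => // _; apply: mul_conjC_ge0.
rewrite ler_nat mulnCA leq_pmul2l; last by apply/card_gt0P; exists c0.
by rewrite mulnC.
Qed.

(* The quadratic part depends on the second components only, so it cancels in
   the alternating sum of four values of theta. *)
Lemma compat_same_fiber kappa (A : {set G * G}) c c' f s t :
  clique (compat kappa) A -> (c, f) \in A -> (c', f) \in A -> s \in A -> t \in A ->
  coord_prod c c' s.2 t.2 \is a Num.int.
Proof.
move=> /cliqueP cA cf c'f sA tA.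
have hs := cA _ _ cf sA; have hs' := cA _ _ c'f sA.
have ht := cA _ _ cf tA; have ht' := cA _ _ c'f tA.
have -> : coord_prod c c' s.2 t.2 = theta kappa (c, f) t - theta kappa (c', f) t
    - (theta kappa (c, f) s - theta kappa (c', f) s).
  have aux u : theta kappa (c, f) u - theta kappa (c', f) u = coord_prod c c' f u.2.
    rewrite /theta /= opprD addrACA subrr addr0 /coord_prod -sumrB.
    by apply: eq_bigr => k _; ring.
  by rewrite !aux coord_prodB.
by rewrite !rpredB.
Qed.

Definition fiber_at (A : {set G * G}) f : {set G} := finset (fun c => (c, f) \in A).

Lemma card_fibers (A : {set G * G}) :
  #|A| = (\sum_(f in snd @: A) #|fiber_at A f|)%N.
Proof.
rewrite -sum1_card (partition_big snd (mem (snd @: A))) /=; last first.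
  by move=> s sA; apply: imset_f.
apply: eq_bigr => f _; rewrite sum1_card.
rewrite -(card_imset _ (_ : injective (fun c => (c, f)))) => [|c c' []//].
apply: eq_card => -[c f']; rewrite [LHS]unfold_in /=; apply/andP/imsetP => [[cA /eqP /= ff]|[c0]].
  by exists c; rewrite ?/fiber_at ?inE -ff.
by rewrite /fiber_at inE => c0A [-> ->].
Qed.

Lemma card_fiber_at_le kappa (A : {set G * G}) f : clique (compat kappa) A ->
  (#|fiber_at A f| * #|snd @: A| <= #|G|)%N.
Proof.
move=> cA; apply: parseval_card => c c'; rewrite /fiber_at !inE => cf c'f.
by move=> _ _ /imsetP[s sA ->] /imsetP[t tA ->]; apply: compat_same_fiber cA cf c'f sA tA.
Qed.

(** With D the second projection of A, every fibre satisfies |fibre| |D| <= |G|; adding this over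
    the |D| fibres and cancelling |D| gives the bound. *)
Lemma clique_card_le kappa (A : {set G * G}) : clique (compat kappa) A -> (#|A| <= #|G|)%N.
Proof.
move=> cA; have [->|[s sA]] := set_0Vmem A; first by rewrite cards0.
have D0 : (0 < #|snd @: A|)%N by apply/card_gt0P; exists s.2; apply: imset_f.
rewrite -(leq_pmul2r D0) card_fibers big_distrl /= mulnC -sum_nat_const.
by apply: leq_sum => f _; apply: card_fiber_at_le cA.
Qed.

(** Dual form of the statement that differences of elements of D generate [G]: only the zero
    character kills all of them. *)
Definition separating (D : {set G}) :=
  forall c c', {in D &, forall f f', coord_prod c c' f f' \is a Num.int} -> c = c'.

Definition graph_set (gam : {ffun G -> G}) : {set G * G} := [set (gam f, f) | f : G]%SET.

Definition graph_cliques kappa : {set {ffun G -> G}} :=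
  finset (fun gam : {ffun G -> G} => [forall f, forall f', compat kappa (gam f, f) (gam f', f')]).

(** Two points in one fibre would contradict separation, so fibres have at most one element; then
    |A| = |G| forces the second projection to be all of [G]. *)
Lemma full_clique_graph kappa (A : {set G * G}) :
  clique (compat kappa) A -> #|A| = #|G| -> separating (snd @: A) ->
  exists2 gam, gam \in graph_cliques kappa & A = graph_set gam.
Proof.
move=> cA AG sep.
have f1 f : (#|fiber_at A f| <= 1)%N.
  rewrite leqNgt; apply/negP => /card_gt1P[c [c' [cf c'f /eqP[]]]].
  rewrite /fiber_at !inE in cf c'f; apply: sep => _ _ /imsetP[s sA ->] /imsetP[t tA ->].
  exact: compat_same_fiber cA cf c'f sA tA.
have DG : snd @: A = finset (fun=> true).
  apply/eqP; rewrite eqEcard cardsE; apply/andP; split; first by apply/fintype.subsetP => f; rewrite inE.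
  rewrite [#|(fun _ => _)|]/= -[X in (X <= _)%N]/#|G| -AG card_fibers -sum1_card.
  by apply: leq_sum => f _; apply: f1.
have ex f : exists c, (c, f) \in A.
  have : f \in snd @: A by rewrite DG inE.
  by move=> /imsetP[[c f'] cA' ->]; exists c.
pose gam := [ffun f => xchoose (ex f)].
have gA f : (gam f, f) \in A by rewrite ffunE; exact: xchooseP (ex f).
exists gam.
  rewrite /graph_cliques inE; apply/forallP => f; apply/forallP => f'.
  by apply: (cliqueP _ _ cA).
apply/esym/eqP; rewrite eqEcard AG; apply/andP; split.
  by apply/fintype.subsetP => _ /imsetP[f _ ->].
by rewrite card_imset // => f f' [].
Qed.

End Parseval.
End PhaseCliques.

Arguments theta {G} S kappa s t.
Arguments compat {G} S kappa.
Arguments graph_cliques {G} S kappa.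
Arguments coord_prod {G} S c c' f f'.
Arguments separating {G} S D.

(** * Counting the graph cliques *)

Section GraphCliqueCount.
Variables (G : finZmodType) (S : cyclic_coords G).
Local Notation r := (crank S).
Local Notation m := (@cord G S).
Local Notation e := (@cbasis G S).
Local Notation x := (@coord G S).
Local Notation X := (@X G S).
Implicit Types (g h c f : G) (k l : 'I_r) (s t : G * G) (kappa : 'I_r * 'I_r -> nat).

Definition cgcd k l : nat := gcdn (m k) (m l).

(* Weight 1 leaves the single value 0 to the entries that do not count. *)
Definition sym_weight (p : 'I_r * 'I_r) : nat := if (p.1 <= p.2)%N then cgcd p.1 p.2 else 1.
Definition alt_weight (p : 'I_r * 'I_r) : nat := if (p.1 < p.2)%N then cgcd p.1 p.2 else 1.

Lemma cgcd_sym k l : cgcd k l = cgcd l k.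
Proof. exact: gcdnC. Qed.

Lemma cgcd_gt0 k l : (0 < cgcd k l)%N.
Proof. by rewrite gcdn_gt0 cord_gt0. Qed.

Lemma cgcd_neq0 k l : (cgcd k l)%:R != 0 :> rat.
Proof. by rewrite pnatr_eq0 -lt0n cgcd_gt0. Qed.

Lemma cgcd_int k l (a : rat) : (m k)%:R * a \is a Num.int -> (m l)%:R * a \is a Num.int ->
  (cgcd k l)%:R * a \is a Num.int.
Proof.
move=> ka la; have [u v uv _] := egcdnP (m l) (cord_gt0 k).
have -> : (cgcd k l)%:R = u%:R * (m k)%:R - v%:R * (m l)%:R :> rat.
  by rewrite -!natrM uv natrD addrC addKr.
by rewrite mulrBl rpredB // -mulrA rpredM ?rpred_nat.
Qed.

(** Polarisation, as in |a|^2 + |b|^2 - |a - b|^2: with base point o, a quadratic expression in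
    differences yields a bilinear one. *)
Lemma theta_polar kappa s t o :
  theta S kappa s o + theta S kappa t o - theta S kappa s t =
  \sum_k ((X s.1 k - X o.1 k) * (X t.2 k - X o.2 k)
          + (X t.1 k - X o.1 k) * (X s.2 k - X o.2 k)) / (m k)%:R
  + \sum_p (kappa p)%:R * ((X s.2 p.1 - X o.2 p.1) * (X t.2 p.2 - X o.2 p.2)
          + (X t.2 p.1 - X o.2 p.1) * (X s.2 p.2 - X o.2 p.2))
      / ((m p.1)%:R * (m p.2)%:R).
Proof.
have shuffle (a b c a' b' c' : rat) :
  a + a' + (b + b') - (c + c') = (a + b - c) + (a' + b' - c') by ring.
rewrite /theta shuffle /coord_prod /quad_part; congr (_ + _).
  by rewrite -[X in X - _]big_split -sumrB; apply: eq_bigr => k _ /=; ring.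
by rewrite -[X in X - _]big_split -sumrB; apply: eq_bigr => k _ /=; ring.
Qed.

Lemma X0 k : X 0 k = 0.
Proof. by rewrite /X coord0. Qed.

Lemma X_basis_neq k l : k != l -> X (e k) l = 0.
Proof. by rewrite /X coord_basis => /negPf ->; rewrite mod0n. Qed.

Lemma X_basis k l : (1 < m k)%N -> X (e k) l = (k == l)%:R.
Proof.
rewrite /X coord_basis; case: eqP => [<- mk|_ _]; last by rewrite mod0n.
by rewrite modn_small.
Qed.

Lemma X_basis_cong k (z : rat) : z \is a Num.int ->
  z * X (e k) k / (m k)%:R - z / (m k)%:R \is a Num.int.
Proof.
move=> zi; rewrite /X coord_basis eqxx.
have := cord_gt0 k; rewrite leq_eqVlt => /orP[/eqP <-|mk].
  by rewrite modn1 !divr1 mulr0 rpredB ?rpred0.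
by rewrite modn_small // mulr1 subrr rpred0.
Qed.

Lemma sum_X_basis (z : 'I_r -> rat) k : z k \is a Num.int ->
  \sum_j z j * X (e k) j / (m j)%:R - z k / (m k)%:R \is a Num.int.
Proof.
move=> zi; rewrite (bigD1 k) //= big1 ?addr0; first exact: X_basis_cong.
by move=> j; rewrite eq_sym => jk; rewrite X_basis_neq // mulr0 mul0r.
Qed.

Lemma sum_X_basis1 (z : 'I_r -> rat) k : (1 < m k)%N ->
  \sum_j z j * X (e k) j / (m j)%:R = z k / (m k)%:R.
Proof.
move=> mk; rewrite (bigD1 k) //= big1 ?addr0; first by rewrite X_basis // eqxx mulr1.
by move=> j; rewrite eq_sym => jk; rewrite X_basis_neq // mulr0 mul0r.
Qed.

(** The clique condition at basis elements forces gcd(m_k, m_l) to divide the entry (k, l) of kappa,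
    and the bound by [sym_weight] leaves only 0. Diagonal entries come from [theta] itself, the
    others from its polarisation. *)
Lemma kappa_eq0 kappa gam : gam \in graph_cliques S kappa ->
  (forall p, kappa p < sym_weight p)%N -> forall p, kappa p = 0%N.
Proof.
rewrite /graph_cliques inE => /forallP cl ks.
have {}cl f f' : compat S kappa (gam f, f) (gam f', f') by move: (cl f) => /forallP.
case=> k l; have := ks (k, l); rewrite /sym_weight /=.
have [kl|_] := leqP k l; last by case: (kappa _).
have [mk|mk] := leqP (m k) 1.
  rewrite /cgcd (_ : m k = 1%N) ?gcd1n; first by case: (kappa _).
  by apply/eqP; rewrite eqn_leq mk cord_gt0.
have [ml|ml] := leqP (m l) 1.
  rewrite /cgcd (_ : m l = 1%N) ?gcdn1; first by case: (kappa _).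
  by apply/eqP; rewrite eqn_leq ml cord_gt0.
have [->|knl] := eqVneq k l.
  have := cl (e l) 0; rewrite /compat /theta /coord_prod /quad_part /=.
  rewrite (bigD1 l) //= big1 ?addr0; last first.
    by move=> j; rewrite eq_sym => jl; rewrite X0 X_basis_neq // subrr mulr0 mul0r.
  rewrite (bigD1 (l, l)) //= big1 ?addr0; last first.
    move=> [i j]; rewrite xpair_eqE /= !X0 !subr0 !X_basis // ![_ == l]eq_sym.
    by case: (l == i); case: (l == j); rewrite ?(mulr0, mul0r).
  rewrite !X0 !subr0 X_basis // eqxx !mulr1 => h.
  have : (kappa (l, l))%:R / (m l)%:R \is a @Num.int rat.
    have -> : (kappa (l, l))%:R / (m l)%:R =
       (m l)%:R * ((X (gam (e l)) l - X (gam 0) l) / (m l)%:R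
          + (kappa (l, l))%:R / ((m l)%:R * (m l)%:R)) - (X (gam (e l)) l - X (gam 0) l).
      by have := cord_neq0 l => ?; field.
    by rewrite rpredB ?rpredM ?rpred_nat // rpredB ?X_int.
  rewrite natr_div_int ?cord_gt0 // /cgcd gcdnn => /dvdnP[[|b] ->]; first by rewrite mul0n.
  by rewrite mulSn -ltn_subRL subnn ltn0.
have klt : (k < l)%N by rewrite ltn_neqAle knl.
have lk0 : kappa (l, k) = 0%N.
  by have := ks (l, k); rewrite /sym_weight /= [(l <= k)%N]leqNgt klt /=; case: (kappa _).
have := rpredB (rpredD (cl (e k) 0) (cl (e l) 0)) (cl (e k) (e l)).
rewrite theta_polar /=.
set D1 := fun j => X (gam (e k)) j - X (gam 0) j.
set D2 := fun j => X (gam (e l)) j - X (gam 0) j.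
rewrite (eq_bigr (fun j => D1 j * X (e l) j / (m j)%:R + D2 j * X (e k) j / (m j)%:R));
  last by move=> j _; rewrite X0 !subr0 mulrDl.
rewrite big_split /= !sum_X_basis1 // (bigD1 (k, l)) //= big1 ?addr0; last first.
  move=> [i j]; rewrite xpair_eqE /= !X0 !subr0 !X_basis // => h.
  have [ki|ki] := eqVneq k i; have [lj|lj] := eqVneq l j;
    have [kj|kj] := eqVneq k j; have [li|li] := eqVneq l i;
    rewrite ?(mulr0, mul0r, addr0) //; subst; rewrite ?eqxx // in h knl *.
  by rewrite lk0 !mul0r.
rewrite !X0 !subr0 !X_basis // !eqxx eq_sym (negPf knl) mul0r addr0 !mulr1 => h.
have [a ma] : exists a, m k = (a * cgcd k l)%N by apply/dvdnP/dvdn_gcdl.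
have [b mb] : exists b, m l = (b * cgcd k l)%N by apply/dvdnP/dvdn_gcdr.
have g0 := cgcd_neq0 k l.
have a0 : a%:R != 0 :> rat by have := cord_neq0 k; rewrite ma natrM mulf_eq0 negb_or => /andP[].
have b0 : b%:R != 0 :> rat by have := cord_neq0 l; rewrite mb natrM mulf_eq0 negb_or => /andP[].
have : (kappa (k, l))%:R / (cgcd k l)%:R \is a @Num.int rat.
  (* Multiplication by lcm(m_k, m_l) = [a * b * cgcd k l] makes the terms in [D1] and [D2] integral
     and turns the kappa term into kappa / gcd. *)
  have -> : (kappa (k, l))%:R / (cgcd k l)%:R = (a * b * cgcd k l)%:R *
     (D1 l / (m l)%:R + D2 k / (m k)%:R + (kappa (k, l))%:R / ((m k)%:R * (m l)%:R))
     - (a%:R * D1 l + b%:R * D2 k).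
    rewrite [in (m k)%:R]ma [in (m l)%:R]mb !natrM; field; by rewrite a0 b0 g0.
  rewrite rpredB ?rpredM ?rpred_nat // rpredD ?rpredM ?rpred_nat // rpredB ?X_int //.
rewrite natr_div_int ?cgcd_gt0 // => /dvdnP[[|c] ->]; first by rewrite mul0n.
by rewrite mulSn -ltn_subRL subnn ltn0.
Qed.

(** A common bound for all weights, so that families of residues with different moduli share one
    finite function type. *)
Definition index_bound : nat := (\sum_k m k)%N.+1.

Lemma cgcd_lt_bound k l : (cgcd k l < index_bound)%N.
Proof.
rewrite ltnS; apply: leq_trans (dvdn_leq (cord_gt0 k) (dvdn_gcdl _ _)) _.
by rewrite (bigD1 k) //= leq_addr.
Qed.

Implicit Types (w : 'I_r * 'I_r -> nat) (a : {ffun 'I_r * 'I_r -> 'I_index_bound}).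

Definition weight_family (w : 'I_r * 'I_r -> nat) : {set {ffun 'I_r * 'I_r -> 'I_index_bound}} :=
  finset (fun a : {ffun 'I_r * 'I_r -> 'I_index_bound} => [forall p, (a p < w p)%N]).

Lemma weight_familyP w a : reflect (forall p, (a p < w p)%N) (a \in weight_family w).
Proof. by rewrite /weight_family inE; apply: forallP. Qed.

Lemma big_weight_family (R : comNzRingType) w (F : 'I_r * 'I_r -> nat -> R) :
  (forall p, w p < index_bound)%N ->
  \prod_p \sum_(a < w p) F p a = \sum_(a in weight_family w) \prod_p F p (a p).
Proof.
move=> wb; under eq_bigr => p _ do rewrite (big_ord_widen index_bound _ (ltnW (wb p))).
rewrite bigA_distr_big_dep; apply: eq_bigl => a.
by apply/familyP/weight_familyP.
Qed.

Lemma sym_weight_bound p : (sym_weight p < index_bound)%N.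
Proof.
rewrite /sym_weight; case: ifP => _; first exact: cgcd_lt_bound.
exact: leq_ltn_trans (cgcd_gt0 p.1 p.2) (cgcd_lt_bound _ _).
Qed.

Lemma alt_weight_bound p : (alt_weight p < index_bound)%N.
Proof.
rewrite /alt_weight; case: ifP => _; first exact: cgcd_lt_bound.
exact: leq_ltn_trans (cgcd_gt0 p.1 p.2) (cgcd_lt_bound _ _).
Qed.

Lemma card_weight_family w : (forall p, w p < index_bound)%N ->
  #|weight_family w| = (\prod_p w p)%N.
Proof.
move=> wb; apply/eqP; rewrite -(eqr_nat int) -sum1_card natr_prod natr_sum.
have := big_weight_family (fun _ _ => 1%:Z) wb.
under [X in _ = X -> _]eq_bigr do rewrite big1 //.
by move=> <-; apply/eqP; apply: eq_bigr => p _; rewrite sumr_const card_ord.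
Qed.

(** A family in [weight_family alt_weight] is supported above the diagonal; this reads it as an
    antisymmetric matrix. *)
Definition alt_entry a k l : int := (a (k, l) : nat)%:Z - (a (l, k) : nat)%:Z.

(* Multiplication by m_l / gcd(m_k, m_l) embeds Z/gcd(m_k, m_l) in Z/m_l. *)
Definition alt_shift a f l : int :=
  \sum_k alt_entry a k l * (x f k)%:Z * (m l %/ cgcd k l)%N%:Z.

Definition alt_map (u : G * {ffun 'I_r * 'I_r -> 'I_index_bound}) : {ffun G -> G} :=
  [ffun f => u.1 + \sum_l e l *~ alt_shift u.2 f l].

Lemma coord_sum_int (z : 'I_r -> int) l :
  (X (\sum_j e j *~ z j) l - (z l)%:~R) / (m l)%:R \is a Num.int.
Proof.
rewrite mulrBl; apply/piQZ_eq; rewrite -[LHS]/(dual_basis l _) raddf_sum /=.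
rewrite (bigD1 l) //= big1 ?addr0 => [|j jl]; last first.
  rewrite raddfMz /= -[dual_basis_fun _ _]/(\pi_QmodZ (X (e j) l / _)).
  by rewrite X_basis_neq // mul0r raddf0 mul0rz.
rewrite raddfMz /= -[dual_basis_fun _ _]/(\pi_QmodZ (X (e l) l / _)).
rewrite -raddfMz; apply/piQZ_eq; have := X_basis_cong l (intr_int rat (z l)).
by congr (_ - _ \is a Num.int); rewrite -[in RHS]mulrzr; ring.
Qed.

(** Read through the characters x_l/m_l, the linear part of [alt_map] has the matrix alt_entry / gcd
    modulo Z, which shows its antisymmetry; in [alt_shift] the moduli m_l hide it. *)
Lemma alt_map_coord u f l :
  (X (alt_map u f) l - X u.1 l) / (m l)%:R
  - \sum_k (alt_entry u.2 k l)%:~R / (cgcd k l)%:R * X f k \is a Num.int.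
Proof.
rewrite ffunE; set d := \sum_l _.
have h1 := coordD_int u.1 d l; have h2 := coord_sum_int (alt_shift u.2 f) l.
have sE : (alt_shift u.2 f l)%:~R / (m l)%:R
    = \sum_k (alt_entry u.2 k l)%:~R / (cgcd k l)%:R * X f k :> rat.
  rewrite /alt_shift rmorph_sum mulr_suml; apply: eq_bigr => k _.
  rewrite !rmorphM /= -!pmulrn -/(X f k).
  have -> : (m l %/ cgcd k l)%N%:R = (m l)%:R / (cgcd k l)%:R :> rat.
    by rewrite -[in RHS](divnK (dvdn_gcdr (m k) (m l))) natrM mulfK ?cgcd_neq0.
  by have := cgcd_neq0 k l; have := cord_neq0 l => ? ?; field; apply/andP.
rewrite -sE; have := rpredD h1 h2; rewrite -/d -/(X _ l) -/(X u.1 l) -/(X d l).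
by congr (_ \is a Num.int); ring.
Qed.

Lemma antisym_sum0 (B : 'I_r -> 'I_r -> rat) : (forall k l, B k l = - B l k) ->
  \sum_l \sum_k B k l = 0.
Proof.
move=> Bas; set s := \sum_l _.
have : s = - s.
  rewrite {1}/s exchange_big /= -sumrN; apply: eq_bigr => k _.
  by rewrite -sumrN; apply: eq_bigr => l _.
by lra.
Qed.

Lemma alt_map_clique u : alt_map u \in graph_cliques S (fun=> 0%N).
Proof.
rewrite /graph_cliques inE; apply/forallP => f; apply/forallP => f'.
rewrite /compat /theta /quad_part big1 ?addr0 => [|p _]; last by rewrite !mul0r.
rewrite /coord_prod /=.
(* The antisymmetric double sum is 0; once it is subtracted, the remaining sum is integral term by
   term by [alt_map_coord]. *)
rewrite -[X in X \is a _]subr0 -[X in _ - X](@antisym_sum0 (fun k l =>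
   (alt_entry u.2 k l)%:~R / (cgcd k l)%:R * (X f k - X f' k) * (X f l - X f' l))); last first.
  by move=> k l; rewrite (cgcd_sym k l) /alt_entry !rmorphB /=; ring.
rewrite -sumrB; apply: rpred_sum => l _.
have := rpredB (alt_map_coord u f l) (alt_map_coord u f' l).
move=> /(rpredM (rpredB (X_int f l) (X_int f' l))).
congr (_ \is a Num.int).
rewrite -mulr_suml; under [in RHS]eq_bigr do rewrite mulrBr.
by rewrite sumrB; ring.
Qed.

Lemma alt_map0 u : alt_map u 0 = u.1.
Proof.
rewrite ffunE big1 ?addr0 // => l _; rewrite /alt_shift big1 ?mulr0z // => k _.
by rewrite coord0 mulr0 mul0r.
Qed.

Lemma alt_entry_lt a k l : a \in weight_family alt_weight -> (k < l)%N ->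
  alt_entry a k l = (a (k, l) : nat)%:Z.
Proof.
move=> /weight_familyP aw kl; rewrite /alt_entry; have := aw (l, k).
rewrite /alt_weight /= [(l < k)%N]ltnNge (ltnW kl) /=; case: (a (l, k)) => -[|n] //= _ _.
by rewrite subr0.
Qed.

Lemma alt_entryN a k l : alt_entry a k l = - alt_entry a l k.
Proof. by rewrite /alt_entry opprB. Qed.

(** The value at 0 recovers the constant, and coordinate l of the value at [e k] recovers the entry
    (k, l) modulo gcd(m_k, m_l). *)
Lemma alt_map_inj : {in finset.setX finset.setT (weight_family alt_weight) &, injective alt_map}.
Proof.
move=> [g a] [g' a']; rewrite !finset.in_setX /= => /andP[_ ha] /andP[_ ha'] eq.
have gg : g = g' by rewrite -[g](alt_map0 (g, a)) -[g'](alt_map0 (g', a')) eq.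
congr (_, _) => //; apply/ffunP => -[k l]; apply: val_inj => /=.
have [kl|kl] := ltnP k l; last first.
  move/weight_familyP: ha => /(_ (k, l)); move/weight_familyP: ha' => /(_ (k, l)).
  rewrite /alt_weight /= [(k < l)%N]ltnNge kl /=.
  by rewrite !ltnS !leqn0 => /eqP -> /eqP ->.
apply: (@natr_eq_mod _ _ (cgcd k l)).
- by move/weight_familyP: ha => /(_ (k, l)); rewrite /alt_weight /= kl.
- by move/weight_familyP: ha' => /(_ (k, l)); rewrite /alt_weight /= kl.
have key b : b \in weight_family alt_weight ->
    (X (alt_map (g, b) (e k)) l - X g l) / (m l)%:R - (b (k, l))%:R / (cgcd k l)%:R \is a Num.int.
  move=> hb; have := alt_map_coord (g, b) (e k) l => /=.
  rewrite (bigD1 k) //= [X in _ - (_ + X)]big1 ?addr0; last first.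
    by move=> j; rewrite eq_sym => jk; rewrite X_basis_neq // mulr0.
  rewrite alt_entry_lt // -pmulrn; set y := _ / (m l)%:R => h1.
  have := cord_gt0 k; rewrite leq_eqVlt => /orP[/eqP mk1|mk]; last first.
    by move: h1; rewrite X_basis // eqxx mulr1.
  have g1 : cgcd k l = 1%N by rewrite /cgcd -mk1 gcd1n.
  by move: h1; rewrite g1 /X coord_basis eqxx -mk1 modn1 mulr0 subr0 !divr1 => h1; rewrite rpredB ?rpred_nat.
have := rpredB (key a' ha') (key a ha); rewrite gg in eq *; rewrite eq.
by congr (_ \is a Num.int); ring.
Qed.

(** Polarisation against [e l] shows that gam - gam(0) is linear in the coordinates modulo Z, with a
    matrix D (e k) l / m_l that is antisymmetric modulo Z. Hence both m_k and m_l annihilate an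
    entry modulo Z, and it is a multiple of 1/gcd(m_k, m_l). *)
Lemma graph_clique_alt gam : gam \in graph_cliques S (fun=> 0%N) ->
  exists2 a, a \in weight_family alt_weight & gam = alt_map (gam 0, a).
Proof.
rewrite /graph_cliques inE => /forallP cl.
have {}cl f f' : compat S (fun=> 0%N) (gam f, f) (gam f', f').
  by move: (cl f) => /forallP.
pose D f l := X (gam f) l - X (gam 0) l.
have Di f l : D f l \is a Num.int by rewrite rpredB ?X_int.
have th0 s t : theta S (fun=> 0%N) s t = coord_prod S s.1 t.1 s.2 t.2.
  by rewrite /theta /quad_part big1 ?addr0 // => p _; rewrite !mul0r.
have polar f f' : \sum_l D f l * X f' l / (m l)%:R
                 + \sum_l D f' l * X f l / (m l)%:R \is a Num.int.
  have := rpredB (rpredD (cl f 0) (cl f' 0)) (cl f f').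
  rewrite theta_polar /= [X in _ + X]big1 ?addr0 => [|p _]; last by rewrite !mul0r.
  rewrite -big_split /=; congr (_ \is a Num.int); apply: eq_bigr => k _.
  by rewrite !X0 !subr0 mulrDl.
have d1 f l : D f l / (m l)%:R + \sum_k D (e l) k * X f k / (m k)%:R \is a Num.int.
  have := rpredB (polar f (e l)) (sum_X_basis (Di f l)).
  by congr (_ \is a Num.int); ring.
have d2 k l : D (e k) l / (m l)%:R + D (e l) k / (m k)%:R \is a Num.int.
  have := rpredB (d1 (e k) l) (sum_X_basis (Di (e l) k)).
  by congr (_ \is a Num.int); ring.
(* Antisymmetry gives only twice the diagonal entry; that the entry itself is integral needs the
   clique condition for [e k] and 0. *)
have d3 k : D (e k) k / (m k)%:R \is a Num.int.
  have := cl (e k) 0; rewrite /compat th0 /= => h.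
  have := rpredB h (sum_X_basis (Di (e k) k)).
  rewrite (_ : coord_prod _ _ _ _ _ = \sum_j D (e k) j * X (e k) j / (m j)%:R).
    by rewrite opprB addrCA subrr addr0.
  by apply: eq_bigr => j _; rewrite X0 subr0.
have d4 f l : D f l / (m l)%:R - \sum_k D (e k) l / (m l)%:R * X f k \is a Num.int.
  have h : \sum_k (D (e k) l / (m l)%:R + D (e l) k / (m k)%:R) * X f k \is a Num.int.
    by apply: rpred_sum => k _; rewrite rpredM ?X_int.
  have := rpredB (d1 f l) h; congr (_ \is a Num.int).
  rewrite -addrA -sumrB -sumrN; congr (_ + _); apply: eq_bigr => k _; ring.
have gD k l : (cgcd k l)%:R * (D (e k) l / (m l)%:R) \is a Num.int.
  apply: cgcd_int; last by rewrite mulrCA divff ?cord_neq0 // mulr1.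
  have := rpredB (rpredM (rpred_nat _ (m k)) (d2 k l)) (Di (e l) k).
  congr (_ \is a Num.int); have := cord_neq0 k; have := cord_neq0 l => ? ?.
  by field; apply/andP.
(* Residue modulo gcd(m_k, m_l) of gcd(m_k, m_l) D (e k) l / m_l, an integer by [gD]; the floor only
   converts it to [int]. *)
pose av (p : 'I_r * 'I_r) : nat := `|(Num.floor ((cgcd p.1 p.2)%:R * (D (e p.1) p.2 / (m p.2)%:R)) %% (cgcd p.1 p.2)%:Z)%Z|%N.
have avlt p : (av p < cgcd p.1 p.2)%N.
  rewrite /av -ltz_nat gez0_abs ?modz_ge0 ?ltz_pmod //.
  - by rewrite ltz_nat cgcd_gt0.
  - by rewrite eqz_nat -lt0n cgcd_gt0.
have avE k l : D (e k) l / (m l)%:R - (av (k, l))%:R / (cgcd k l)%:R \is a Num.int.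
  rewrite /av /=; set z := Num.floor _.
  have zE : z%:~R = (cgcd k l)%:R * (D (e k) l / (m l)%:R) by apply/eqP; rewrite -intrEfloor gD.
  have -> : (`|(z %% (cgcd k l)%:Z)%Z|%N)%:R = z%:~R - (z %/ (cgcd k l)%:Z)%Z%:~R * (cgcd k l)%:R :> rat.
    rewrite pmulrn gez0_abs ?modz_ge0 ?eqz_nat -?lt0n ?cgcd_gt0 //.
    by rewrite /modz rmorphB rmorphM /= -pmulrn.
  rewrite zE.
  have -> : forall w : rat, D (e k) l / (m l)%:R - ((cgcd k l)%:R * (D (e k) l / (m l)%:R) - w * (cgcd k l)%:R) / (cgcd k l)%:R = w.
    by move=> w; have := cgcd_neq0 k l; have := cord_neq0 l => ? ?; field; apply/andP.
  exact: intr_int.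
pose a : {ffun 'I_r * 'I_r -> 'I_index_bound} := 
    [ffun p : 'I_r * 'I_r => if (p.1 < p.2)%N then inord (av p) else ord0].
have aE k l : (k < l)%N -> a (k, l) = av (k, l) :> nat.
  by move=> kl; rewrite ffunE /= kl inordK // (leq_ltn_trans (ltnW (avlt _))) ?cgcd_lt_bound.
have aw : a \in weight_family alt_weight.
  apply/weight_familyP => p; rewrite ffunE /alt_weight; case: ifP => // pl.
  by rewrite inordK // (leq_ltn_trans (ltnW (avlt _))) ?cgcd_lt_bound.
have ent k l : D (e k) l / (m l)%:R - (alt_entry a k l)%:~R / (cgcd k l)%:R \is a Num.int.
  have [kl|lk|kl] := ltngtP k l.
  - by rewrite alt_entry_lt // -pmulrn aE.
  - rewrite alt_entryN alt_entry_lt // rmorphN /= -pmulrn aE // cgcd_sym.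
    have := rpredB (d2 k l) (avE l k); congr (_ \is a Num.int); ring.
  - by rewrite (val_inj kl) /alt_entry subrr mul0r subr0.
exists a => //; apply/ffunP => f; apply: (@coord_inj _ S) => l.
apply: (@natr_eq_mod _ _ (m l)); rewrite ?coord_lt // -/(X _ l) -/(X _ l).
have h : \sum_k (D (e k) l / (m l)%:R - (alt_entry a k l)%:~R / (cgcd k l)%:R) * X f k \is a Num.int.
  by apply: rpred_sum => k _; rewrite rpredM ?X_int.
have := rpredD (rpredB (d4 f l) (alt_map_coord (gam 0, a) f l)) h.
congr (_ \is a Num.int); rewrite [X in _ + X](eq_bigr _ (fun k _ => mulrBl _ _ _)) sumrB /=.
by rewrite /D; ring.
Qed.

Lemma card_graph_cliques0 :
  #|graph_cliques S (fun=> 0%N)| = (#|G| * \prod_p alt_weight p)%N.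
Proof.
rewrite -(card_weight_family alt_weight_bound) -[X in (X * _)%N]cardsT -cardsX.
rewrite -(card_in_imset (f := alt_map)); last by move=> u v; apply: alt_map_inj.
apply: eq_card => gam; apply/idP/imsetP => [/graph_clique_alt[a aw ->]|[u _ ->]].
  by exists (gam 0, a); rewrite // finset.in_setX /= inE.
exact: alt_map_clique.
Qed.

(** The weights differ only on the diagonal, where gcd(m_k, m_k) = m_k stands against 1, and the
    orders m_k multiply to |G|. *)
Lemma sym_alt_weight : (\prod_p sym_weight p = #|G| * \prod_p alt_weight p)%N.
Proof.
have split_prod w : (\prod_p w p = \prod_k \prod_l w (k, l))%N.
  by rewrite pair_bigA; apply: eq_bigr => -[].
rewrite (card_prod_cord S) !split_prod -big_split /=.
apply: eq_bigr => k _; rewrite (bigD1 k) //= [in RHS](bigD1 k) //=.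
rewrite /sym_weight /alt_weight /= leqnn ltnn /cgcd gcdnn mul1n; congr (_ * _)%N.
by apply: eq_bigr => l lk; rewrite ltn_neqAle eq_sym lk.
Qed.

End GraphCliqueCount.

(** * Expectation over the random graph *)

Lemma big_ord_pairs (T : Type) (idx : T) (op : Monoid.com_law idx) n (H : 'I_n * 'I_n -> T) :
  \big[op/idx]_p H p =
  op (\big[op/idx]_(p : 'I_n * 'I_n | (p.1 < p.2)%N) op (H p) (H (p.2, p.1)))
     (\big[op/idx]_(i < n) H (i, i)).
Proof.
rewrite (bigID (fun p : 'I_n * 'I_n => p.1 < p.2)%N) /= big_split /= -Monoid.mulmA; congr (op _ _).
rewrite (bigID (fun p : 'I_n * 'I_n => p.2 < p.1)%N) /=; congr (op _ _).
  rewrite (reindex (fun p : 'I_n * 'I_n => (p.2, p.1))) /=; last first.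
    by exists (fun p => (p.2, p.1)) => -[].
  by apply: eq_bigl => p; rewrite -leqNgt andb_idl // => /ltnW.
rewrite (reindex_onto (fun i : 'I_n => (i, i)) fst) /=; last first.
  by case=> i j /=; rewrite -!leqNgt -eqn_leq => /eqP/val_inj ->.
by apply: eq_bigl => i; rewrite ltnn eqxx.
Qed.

Lemma set2_lt_inj n (p p' : 'I_n * 'I_n) : (p.1 < p.2)%N -> (p'.1 < p'.2)%N ->
  [set p.1; p.2]%SET = [set p'.1; p'.2]%SET -> p = p'.
Proof.
case: p p' => i j [i' j'] /= ij ij' /setP eq.
have := eq i; have := eq j; have := eq i'; rewrite !inE !eqxx ?orbT /=.
move=> /orP[] /eqP h1 /esym/orP[] /eqP h2 /esym/orP[] /eqP h3; subst => //;
  by rewrite ?ltnn // in ij ij' *; have := ltn_trans ij ij'; rewrite ltnn.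
Qed.

Lemma big_vpairs (T : Type) (idx : T) (op : Monoid.com_law idx) n (F : {set 'I_n} -> T) :
  \big[op/idx]_(e in vpairs n) F e =
  \big[op/idx]_(p : 'I_n * 'I_n | (p.1 < p.2)%N) F [set p.1; p.2]%SET.
Proof.
pose A : {set 'I_n * 'I_n} := finset (fun p : 'I_n * 'I_n => p.1 < p.2)%N.
have -> : vpairs n = (fun p : 'I_n * 'I_n => [set p.1; p.2]%SET) @: A.
  apply/setP => e; rewrite inE; apply/cards2P/imsetP => [[i [j [ij ->]]]|[p]].
    have [lij|lji|/val_inj/eqP] := ltngtP i j; last by rewrite (negPf ij).
      by exists (i, j); rewrite ?inE.
    by exists (j, i); rewrite ?inE //= finset.setUC.
  by rewrite inE => lp ->; exists p.1, p.2; rewrite neq_ltn lp.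
rewrite big_imset /=; first by apply: eq_bigl => p; rewrite inE.
by move=> p p'; rewrite !inE => lp lp'; apply: set2_lt_inj.
Qed.

Section GraphExpectation.
Variables (R : comNzRingType) (n : nat).

Lemma sum_sgraph_prod (a b : {set 'I_n} -> R) :
  \sum_(g : sgraph n) \prod_(e in vpairs n) (if e \in val g then a e else b e)
  = \prod_(e in vpairs n) (a e + b e).
Proof.
(* The weights 0 and 1 at sets that are not pairs let the product range over all sets of vertices
   and remove the families that are not graphs. *)
pose a' e : R := if e \in vpairs n then a e else 0.
pose b' e : R := if e \in vpairs n then b e else 1.
transitivity (\prod_(e : {set 'I_n}) (a' e + b' e)); last first.
  rewrite [RHS]big_mkcond; apply: eq_bigr => e _; rewrite /a' /b'.
  by case: ifP => _ //; rewrite add0r.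
rewrite bigA_distr (bigID (fun E : {set {set 'I_n}} => E \subset vpairs n)) /=.
rewrite [X in _ + X]big1 ?addr0 => [|E /subsetPn[e eE /negPf eV]]; last first.
  by rewrite (bigD1 e) //= eE /a' eV mul0r.
rewrite [RHS](reindex_omap (val : sgraph n -> _) insub) /=; last first.
  by move=> E hE; rewrite insubT.
apply: eq_big => [g|g _]; first by rewrite (valP g) valK eqxx.
rewrite big_mkcond; apply: eq_bigr => e _; rewrite /a' /b'.
case: ifP => // eV; case: ifP => // eg.
by have := fintype.subsetP (valP g) _ eg; rewrite eV.
Qed.

End GraphExpectation.

(** Edges are independent, so the expectation of the product is the product of the one-edge
    expectations. *)
Lemma gnq_sum_prod_adj (R : realType) (q : R) n (z : 'I_n -> 'I_n -> R[i]) :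
  \sum_(g : sgraph n) (gnq_weight q g)%:C%C *
     \prod_(p : 'I_n * 'I_n | (p.1 < p.2)%N) (if adj g p.1 p.2 then z p.1 p.2 else 1)
  = \prod_(p : 'I_n * 'I_n | (p.1 < p.2)%N) ((1 - q)%:C%C + q%:C%C * z p.1 p.2).
Proof.
(* An edge is the set of exactly one increasing pair p; the product over such p transports z from
   pairs to sets. *)
pose a (e : {set 'I_n}) : R[i] := q%:C%C *
  \prod_(p : 'I_n * 'I_n | (p.1 < p.2)%N && ([set p.1; p.2]%SET == e)) z p.1 p.2.
have aE (p : 'I_n * 'I_n) : (p.1 < p.2)%N -> a [set p.1; p.2]%SET = q%:C%C * z p.1 p.2.
  move=> lp; rewrite /a (big_pred1 p) // => p'; apply/andP/eqP => [[lp' /eqP]|-> //].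
  exact: set2_lt_inj.
transitivity (\prod_(e in vpairs n) (a e + (1 - q)%:C%C)); last first.
  by rewrite big_vpairs; apply: eq_bigr => p lp; rewrite aE // addrC.
rewrite -sum_sgraph_prod; apply: eq_bigr => g _.
rewrite /gnq_weight rmorph_prod /= !big_vpairs -big_split /=; apply: eq_bigr => p lp.
by rewrite /adj; case: ifP => _; rewrite ?mulr1 ?aE.
Qed.

(** * The Laplacian as a bilinear form *)

Section LaplacianForm.
Variables (n : nat) (g : sgraph n).
Implicit Types xx yy : 'I_n -> rat.

Definition lap_form xx yy : rat :=
  \sum_j (\sum_i xx i * (laplacian g i j)%:~R) * yy j.

Lemma laplacianC i j : laplacian g i j = laplacian g j i.
Proof. by rewrite -[in LHS]laplacian_sym [LHS]mxE. Qed.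

Lemma lap_form_sym xx yy : lap_form xx yy = lap_form yy xx.
Proof.
rewrite /lap_form; under eq_bigr do rewrite mulr_suml.
rewrite exchange_big /=; apply: eq_bigr => i _; rewrite mulr_suml.
apply: eq_bigr => j _; rewrite (laplacianC j i); ring.
Qed.

(** The Dirichlet form of the graph, negative because the diagonal of this Laplacian is minus the
    degree. *)
Lemma lap_formE xx yy : lap_form xx yy =
  - \sum_(p : 'I_n * 'I_n | (p.1 < p.2)%N)
      (if adj g p.1 p.2 then (xx p.1 - xx p.2) * (yy p.1 - yy p.2) else 0).
Proof.
rewrite lap_form_sym /lap_form.
transitivity (\sum_j \sum_i (if adj g i j then (yy i - yy j) * xx j else 0)).
  apply: eq_bigr => j _; rewrite mulr_suml.
  (* Since columns of the Laplacian sum to 0, [yy i] may be replaced by [yy i - yy j], which removes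
     the diagonal entries. *)
  have Lj0 : \sum_i (laplacian g i j)%:~R = 0 :> rat.
    rewrite -rmorph_sum /= (eq_bigr (fun i => laplacian g j i)) ?sum_laplacian // => i _.
    exact: laplacianC.
  transitivity (\sum_i yy i * (laplacian g i j)%:~R * xx j
               - (\sum_i (laplacian g i j)%:~R) * (yy j * xx j)).
    by rewrite Lj0 mul0r subr0.
  rewrite mulr_suml -sumrB; apply: eq_bigr => i _.
  have [->|ij] := eqVneq i j; first by rewrite adj_irr; ring.
  by rewrite mxE (negPf ij); case: adj; rewrite /= ?mulr1z ?mulr0z; ring.
rewrite exchange_big pair_bigA big_ord_pairs /= [X in _ + X]big1 ?addr0 => [|i _]; last first.
  by rewrite adj_irr.
rewrite -sumrN; apply: eq_bigr => p _; rewrite (adj_sym g p.2).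
by case: ifP => _; rewrite ?addr0 ?oppr0 //; ring.
Qed.

End LaplacianForm.

(** * Fourier expansion of the two conditions on a vertex map *)

Section FourierExpansion.
Variables (R : realType) (G : finZmodType) (S : cyclic_coords G).
Local Notation r := (crank S).
Local Notation m := (@cord G S).
Local Notation x := (@coord G S).
Local Notation X := (@X G S).
Variable b : 'I_r * 'I_r -> rat.
Hypothesis b_ord : forall p : 'I_r * 'I_r, (p.1 <= p.2)%N -> (cgcd p.1 p.2)%:R * b p \is a Num.int.
Variable n : nat.
Implicit Types (g : sgraph n) (f c : {ffun 'I_n -> G}) (t : {ffun 'I_n -> G * G}).

Definition hom_form g f (k l : 'I_r) : rat :=
  lap_form g (fun i => X (f i) k) (fun i => X (f i) l) / ((m k)%:R * (m l)%:R).

Definition kills_laplacian g f : bool :=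
  [forall j, forall k, (\sum_i X (f i) k * (laplacian g i j)%:~R) / (m k)%:R \is a Num.int].

Definition realizes_form g f : bool :=
  [forall p : 'I_r * 'I_r, (p.1 <= p.2)%N ==> (hom_form g f p.1 p.2 - b p \is a Num.int)].

Definition pair_ffun c f : {ffun 'I_n -> G * G} := [ffun i => (c i, f i)].

Definition phase g (kappa : 'I_r * 'I_r -> nat) t : rat :=
  \sum_(p : 'I_n * 'I_n | (p.1 < p.2)%N)
    (if adj g p.1 p.2 then - theta S kappa (t p.1) (t p.2) else 0).

Lemma phaseE g kappa c f :
  phase g kappa (pair_ffun c f) =
  \sum_j \sum_k (x (c j) k)%:R * ((\sum_i X (f i) k * (laplacian g i j)%:~R) / (m k)%:R)
  + \sum_p (kappa p)%:R * hom_form g f p.1 p.2.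
Proof.
have -> : \sum_j \sum_k (x (c j) k)%:R
        * ((\sum_i X (f i) k * (laplacian g i j)%:~R) / (m k)%:R) =
    \sum_k \sum_(p : 'I_n * 'I_n | (p.1 < p.2)%N) (if adj g p.1 p.2 then
      - ((X (c p.1) k - X (c p.2) k) * (X (f p.1) k - X (f p.2) k) / (m k)%:R) else 0).
  rewrite exchange_big /=; apply: eq_bigr => k _.
  transitivity (lap_form g (fun i => X (f i) k) (fun i => X (c i) k) / (m k)%:R).
    rewrite /lap_form mulr_suml; apply: eq_bigr => j _; rewrite -/(X (c j) k); ring.
  rewrite lap_formE mulNr mulr_suml -sumrN; apply: eq_bigr => p _.
  by case: ifP => _; [ring|rewrite mul0r oppr0].
have -> : \sum_p (kappa p)%:R * hom_form g f p.1 p.2 =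
    \sum_l \sum_(p : 'I_n * 'I_n | (p.1 < p.2)%N) (if adj g p.1 p.2 then
      - ((kappa l)%:R * (X (f p.1) l.1 - X (f p.2) l.1) * (X (f p.1) l.2 - X (f p.2) l.2)
         / ((m l.1)%:R * (m l.2)%:R)) else 0).
  apply: eq_bigr => l _; rewrite /hom_form lap_formE mulNr mulrN mulr_suml mulr_sumr -sumrN.
  by apply: eq_bigr => p _; case: ifP => _; [ring|rewrite mul0r mulr0 oppr0].
rewrite [X in _ = X + _]exchange_big [X in _ = _ + X]exchange_big -big_split /=.
apply: eq_bigr => p _; case: ifP => _; last by rewrite !big1 ?addr0.
by rewrite /theta opprD !ffunE /= /coord_prod /quad_part -!sumrN.
Qed.

(** If f L = 0 in [G], then x_k(f) L / m_k is an integral vector, and it is paired with the integral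
    vector x_l(f). *)
Lemma hom_form_ord g f k l : kills_laplacian g f -> (m l)%:R * hom_form g f k l \is a Num.int.
Proof.
move=> /forallP kl.
have -> : (m l)%:R * hom_form g f k l =
    \sum_j (\sum_i X (f i) k * (laplacian g i j)%:~R) / (m k)%:R * X (f j) l.
  rewrite /hom_form /lap_form mulr_suml mulr_sumr; apply: eq_bigr => j _.
  by have := cord_neq0 k; have := cord_neq0 l => ? ?; field; apply/andP.
apply: rpred_sum => j _; rewrite rpredM ?X_int //; exact: (forallP (kl j)).
Qed.

Lemma hom_form_sym g f k l : hom_form g f k l = hom_form g f l k.
Proof. by rewrite /hom_form lap_form_sym [_%:R * _]mulrC. Qed.

Local Notation W := ((\prod_p @sym_weight G S p)%N%:R : R[i]).
Local Notation N := (#|G|%:R : R[i]).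

(** The sum over c detects f L = 0 by orthogonality on G^n. Given that, gcd(m_k, m_l) annihilates
    [hom_form] - b modulo Z, so the sum over kappa below this gcd detects the second condition. *)
Lemma fourier_indicator g f :
  ((kills_laplacian g f && realizes_form g f)%:R : R[i]) =
  N ^- n * W^-1 * \sum_(kappa in weight_family (@sym_weight G S)) \sum_c
     ec R (phase g (fun p => kappa p : nat) (pair_ffun c f) - \sum_p (kappa p)%:R * b p).
Proof.
have N0 : N != 0 by rewrite pnatr_eq0 -lt0n; apply/card_gt0P; exists 0.
have W0 : W != 0.
  rewrite pnatr_eq0 -lt0n prodn_gt0 // => p; rewrite /sym_weight; case: ifP => // _.
  exact: cgcd_gt0.
pose y j k : int := \sum_i (x (f i) k)%:Z * laplacian g i j.
have yE j k : \sum_i X (f i) k * (laplacian g i j)%:~R = (y j k)%:~R.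
  by rewrite rmorph_sum; apply: eq_bigr => i _; rewrite rmorphM /= -pmulrn.
transitivity (N ^- n * W^-1 *
  ((\sum_(c : {ffun 'I_n -> G}) \prod_j ec R (\sum_k (x (c j) k)%:R * ((y j k)%:~R / (m k)%:R))) *
   \sum_(kappa in weight_family (@sym_weight G S))
     \prod_p ec R ((kappa p)%:R * (hom_form g f p.1 p.2 - b p)))); last first.
  congr (_ * _); rewrite mulr_sumr; apply: eq_bigr => kappa _.
  rewrite mulr_suml; apply: eq_bigr => c _.
  rewrite phaseE -addrA ecD -sumrB -!ec_sum; congr (ec R _ * ec R _).
    by apply: eq_bigr => j _; apply: eq_bigr => k _; rewrite yE.
  by apply: eq_bigr => p _; rewrite mulrBr.
rewrite -(bigA_distr_bigA (fun (j : 'I_n) (h : G) =>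
  ec R (\sum_k (x h k)%:R * ((y j k)%:~R / (m k)%:R)))).
under [X in _ * (X * _)]eq_bigr do rewrite sum_ec_coord.
have [kill|] := boolP (kills_laplacian g f); last first.
  rewrite negb_forall => /existsP[j]; rewrite negb_forall => /existsP[k hk].
  rewrite (bigD1 j) //= ifN ?mul0r ?mulr0 // negb_forall; apply/existsP; exists k.
  by rewrite -yE.
rewrite [X in _ = _ * (X * _)](_ : _ = N ^+ n); last first.
  rewrite -[in RHS](card_ord n) -prodr_const; apply: eq_bigr => j _; rewrite ifT //.
  apply/forallP => k; rewrite -yE; move/forallP: kill => /(_ j) /forallP; exact.
rewrite -(big_weight_family (fun p a => ec R (a%:R * (hom_form g f p.1 p.2 - b p))));
  last exact: sym_weight_bound.
have facE p : \sum_(a < sym_weight p) ec R (a%:R * (hom_form g f p.1 p.2 - b p)) =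
    if (p.1 <= p.2)%N ==> (hom_form g f p.1 p.2 - b p \is a Num.int)
    then (sym_weight p)%:R else 0.
  rewrite /sym_weight; case: ifPn => /= lp; last by rewrite big_ord1 mul0r ec0.
  apply: sum_ec; rewrite mulrBr rpredB ?b_ord //.
  by apply: cgcd_int; [rewrite hom_form_sym|]; apply: hom_form_ord.
under [X in _ * (_ * X)]eq_bigr do rewrite facE.
have [real|] := boolP (realizes_form g f); last first.
  rewrite negb_forall => /existsP[p hp].
  by rewrite [X in _ * (_ * X)](bigD1 p) //= (negPf hp) mul0r !mulr0.
rewrite [X in _ = _ * (_ * X)](_ : _ = W) /=.
  by rewrite mulrACA mulVf ?expf_neq0 // mulVf // mulr1.
rewrite natr_prod; apply: eq_bigr => p _; rewrite ifT //; exact: (forallP real).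
Qed.

Lemma sum_pair_ffun (V : nmodType) (P : pred {ffun 'I_n -> G}) (F : {ffun 'I_n -> G * G} -> V) :
  \sum_(f | P f) \sum_c F (pair_ffun c f) =
  \sum_(t : {ffun 'I_n -> G * G} | P [ffun i => (t i).2]) F t.
Proof.
rewrite pair_big /= (reindex (fun t : {ffun 'I_n -> G * G} =>
   ([ffun i => (t i).2], [ffun i => (t i).1]) : {ffun _} * {ffun _})) /=; last first.
  exists (fun u => pair_ffun u.2 u.1) => [t _|[f c] _].
    by apply/ffunP => i; rewrite !ffunE; case: (t i).
  by congr (_, _); apply/ffunP => i; rewrite !ffunE.
apply: eq_big => t; first by rewrite andbT.
by move=> _; congr F; apply/ffunP => i; rewrite !ffunE; case: (t i).
Qed.

(** The phase is a sum over edges, so independence turns each expected character into a product of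
    [psi]. *)
Lemma expected_good_maps (q : R) (P : pred {ffun 'I_n -> G}) :
  \sum_(g : sgraph n) (gnq_weight q g)%:C%C *
     \sum_(f | P f) ((kills_laplacian g f && realizes_form g f)%:R : R[i]) =
  N ^- n * W^-1 * \sum_(kappa in weight_family (@sym_weight G S))
     ec R (- \sum_p (kappa p)%:R * b p) *
     \sum_(t : {ffun 'I_n -> G * G} | P [ffun i => (t i).2])
        \prod_(p : 'I_n * 'I_n | (p.1 < p.2)%N) psi q (- theta S (fun p => kappa p : nat) (t p.1) (t p.2)).
Proof.
have step g : \sum_(f | P f) ((kills_laplacian g f && realizes_form g f)%:R : R[i]) =
    N ^- n * W^-1 * \sum_(kappa in weight_family (@sym_weight G S))
      ec R (- \sum_p (kappa p)%:R * b p) *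
      \sum_(t : {ffun 'I_n -> G * G} | P [ffun i => (t i).2])
        \prod_(p : 'I_n * 'I_n | (p.1 < p.2)%N)
          (if adj g p.1 p.2 then ec R (- theta S (fun p => kappa p : nat) (t p.1) (t p.2)) else 1).
  under [LHS]eq_bigr do rewrite fourier_indicator.
  rewrite -mulr_sumr exchange_big /=; congr (_ * _); apply: eq_bigr => kappa _.
  rewrite -sum_pair_ffun mulr_sumr; apply: eq_bigr => f _.
  rewrite mulr_sumr; apply: eq_bigr => c _.
  rewrite ecD mulrC; congr (_ * _); rewrite /phase ec_sum; apply: eq_bigr => p _.
  by case: ifP => _ //; rewrite ec0.
under [LHS]eq_bigr do rewrite step mulrCA.
rewrite -mulr_sumr; congr (_ * _); under [LHS]eq_bigr do rewrite mulr_sumr.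
rewrite exchange_big /=; apply: eq_bigr => kappa _.
under [LHS]eq_bigr do rewrite mulrCA.
rewrite -mulr_sumr; congr (_ * _); under [LHS]eq_bigr do rewrite mulr_sumr.
rewrite exchange_big /=; apply: eq_bigr => t _.
by rewrite (gnq_sum_prod_adj q (fun i j => ec R (- theta S (fun p => kappa p : nat) (t i) (t j)))).
Qed.

End FourierExpansion.

(** * Sandpile surjections as maps on vertices *)

Section DualGroup.
Variables (G : finZmodType) (S : cyclic_coords G).
Local Notation r := (crank S).
Local Notation m := (@cord G S).
Local Notation e := (@cbasis G S).
Local Notation x := (@coord G S).

Lemma hom_sumE (A B : zmodType) (I : Type) (s : seq I) (P : pred I)
    (F : I -> {additive A -> B}) a :
  (\sum_(i <- s | P i) F i) a = \sum_(i <- s | P i) F i a.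
Proof. by elim/big_rec2: _ => // i y h _ <-. Qed.

Lemma hom_mulrzE (A B : zmodType) (F : {additive A -> B}) (z : int) a : (F *~ z) a = F a *~ z.
Proof.
have nat k : (F *+ k) a = F a *+ k by elim: k => [|k IH]; rewrite ?mulr0n // !mulrS /= -IH.
by case: z => k; [exact: nat|rewrite !NegzE !mulrNz -!pmulrn -nat].
Qed.

Lemma dual_basis_span (u : dualQZ G) :
  exists z : 'I_r -> int, u = \sum_k dual_basis k *~ z k.
Proof.
pose y k : rat := repr (u (e k)).
have yi k : y k * (m k)%:R \is a Num.int.
  apply/piQZ_eq0; rewrite mulr_natr raddfMn /= reprK -raddfMn cbasis_ord; exact: raddf0.
exists (fun k => Num.floor (y k * (m k)%:R)); apply: additive_ext => g.
rewrite {1}(coord_sum S g) raddf_sum hom_sumE; apply: eq_bigr => k _.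
rewrite hom_mulrzE dual_basisE raddfMn /= -[u (e k)]reprK -/(y k) -raddfMn -raddfMz.
congr (\pi _); rewrite -mulrzr; have /eqP -> : (Num.floor (y k * (m k)%:R))%:~R == y k * (m k)%:R.
  by rewrite -intrEfloor.
by rewrite -[_ *+ x g k]mulr_natr; have := cord_neq0 k => ?; field.
Qed.

(** The characters [dual_basis] generate the dual group, and symmetry supplies the pairs k > l. *)
Lemma symmetric_pairing_ext (B1 B2 : dualQZ G -> dualQZ G -> QmodZ) :
  symmetric_pairing B1 -> symmetric_pairing B2 ->
  (forall k l : 'I_r, (k <= l)%N -> B1 (dual_basis k) (dual_basis l) = B2 (dual_basis k) (dual_basis l)) ->
  forall u v, B1 u v = B2 u v.
Proof.
move=> s1 s2 B12.
have ex (B : dualQZ G -> dualQZ G -> QmodZ) (I : finType) (F : I -> dualQZ G) (z : I -> int) u :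
    symmetric_pairing B -> B u (\sum_i F i *~ z i) = \sum_i B u (F i) *~ z i.
  case=> + _ _ => /(_ u) Bu.
  pose H : {additive _ -> _} := HB.pack (B u) (GRing.isZmodMorphism.Build _ _ (B u) Bu).
  rewrite -[LHS]/(H _) raddf_sum; apply: eq_bigr => i _; exact: raddfMz.
have c1 u v : B1 u v = B1 v u by case: s1.
have c2 u v : B2 u v = B2 v u by case: s2.
have h1 (k l : 'I_r) : B1 (dual_basis k) (dual_basis l) = B2 (dual_basis k) (dual_basis l).
  have [kl|/ltnW lk] := leqP k l; first exact: B12.
  by rewrite c1 c2 B12.
move=> u v; have [zu ->] := dual_basis_span u; have [zv ->] := dual_basis_span v.
rewrite !ex //; apply: eq_bigr => l _; congr (_ *~ _).
rewrite c1 c2 !ex //.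
by apply: eq_bigr => k _; rewrite h1.
Qed.

Variable bG : dualQZ G -> dualQZ G -> QmodZ.
Hypothesis bG_sym : symmetric_pairing bG.

Definition pairing_lift (p : 'I_r * 'I_r) : rat := repr (bG (dual_basis p.1) (dual_basis p.2)).

Lemma dual_basis_ord (k : 'I_r) : dual_basis k *+ m k = 0 :> dualQZ G.
Proof.
apply: additive_ext => g; rewrite pmulrn hom_mulrzE -pmulrn dual_basisE -raddfMn /=.
apply/piQZ_eq0; rewrite -[_ / _ *+ _]mulr_natr divfK ?cord_neq0 // rpred_nat //.
Qed.

Lemma pairing_lift_ord p : (cgcd p.1 p.2)%:R * pairing_lift p \is a Num.int.
Proof.
have aux (B : dualQZ G -> dualQZ G -> QmodZ) u (k : 'I_r) : (forall v, zmod_morphism (B v)) ->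
    B u (dual_basis k) *+ m k = 0.
  move=> /(_ u) Bu.
  pose H : {additive _ -> _} := HB.pack (B u) (GRing.isZmodMorphism.Build _ _ (B u) Bu).
  by rewrite -[B u _]/(H _) -raddfMn dual_basis_ord raddf0.
have [b1 b2 b3] := bG_sym.
apply: cgcd_int; apply/piQZ_eq0; rewrite mulr_natl raddfMn /= reprK; last exact: aux.
by rewrite b3; apply: aux.
Qed.

End DualGroup.

(** * Homomorphisms from the sandpile group and their vertex maps *)

Section SurReduction.
Variables (G : finZmodType) (S : cyclic_coords G).
Local Notation r := (crank S).
Local Notation m := (@cord G S).
Local Notation e := (@cbasis G S).
Local Notation x := (@coord G S).
Local Notation X := (@X G S).
Variables (bG : dualQZ G -> dualQZ G -> QmodZ).
Hypothesis bG_sym : symmetric_pairing bG.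

Definition eval_map n (f : {ffun 'I_n -> G}) (w : 'cV[int]_n) : G := \sum_i f i *~ w i 0.

Fact eval_map_is_additive n (f : {ffun 'I_n -> G}) : zmod_morphism (eval_map f).
Proof.
move=> w w'; rewrite /eval_map -sumrB; apply: eq_bigr => i _.
by rewrite !mxE mulrzBr.
Qed.
HB.instance Definition _ n (f : {ffun 'I_n -> G}) :=
  GRing.isZmodMorphism.Build _ _ (eval_map f) (eval_map_is_additive f).

(** Counterpart of surjectivity on the sandpile group: only combinations of coordinate sum 0 count,
    so the differences of values must generate. *)
Definition generates n (f : {ffun 'I_n -> G}) : bool :=
  `[< forall a : G, exists z : Zsum0 n, eval_map f (val z) = a >].

Lemma kills_laplacianP n (g : sgraph n) (f : {ffun 'I_n -> G}) :
  reflect (forall w, eval_map f (laplacian g *m w) = 0) (kills_laplacian S g f).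
Proof.
have key j k : dual_basis k (eval_map f (laplacian g *m delta_mx j 0)) =
    \pi_QmodZ ((\sum_i X (f i) k * (laplacian g i j)%:~R) / (m k)%:R).
  rewrite /eval_map raddf_sum mulr_suml raddf_sum; apply: eq_bigr => i _ /=.
  rewrite raddfMz /= -colE mxE -[dual_basis_fun _ _]/(\pi_QmodZ (X (f i) k / _)) -raddfMz.
  by congr (\pi _); rewrite -mulrzr; ring.
apply: (iffP idP) => [/forallP kl w|kl].
  have dj j : eval_map f (laplacian g *m delta_mx j 0) = 0.
    apply: (@dual_basis_eq0 _ S) => k; rewrite key; apply/piQZ_eq0.
    exact: (forallP (kl j)).
  rewrite [w]matrix_sum_delta mulmx_sumr raddf_sum big1 // => j _.
  by rewrite big_ord1 -scalemxAr -[w j 0]intz scaler_int raddfMz /= dj mul0rz.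
apply/forallP => j; apply/forallP => k; apply/piQZ_eq0; rewrite -key kl; exact: raddf0.
Qed.

Section FixedGraph.
Variables (n : nat) (g : sgraph n.+1).
Local Notation L := (laplacian g).
Implicit Types (f : {ffun 'I_n.+1 -> G}) (F : {additive sandpile g -> G}).

Lemma diff_sum0 i : delta_mx i 0 - delta_mx 0 0 \in @sum0 n.+1.
Proof.
apply/eqP; under eq_bigr do rewrite !mxE.
rewrite sumrB (bigD1 i) //= big1 => [|j /negPf ->//].
by rewrite (bigD1 0) //= big1 => [|j /negPf ->//]; rewrite eqxx.
Qed.

(** An extension of F from Z to Z^n is fixed by its value a at vertex 0, so F gives |G| vertex
    maps. *)
Definition map_of_hom F (a : G) : {ffun 'I_n.+1 -> G} :=
  [ffun i => a + F (\pi_(sandpile g) (MkZsum0 (diff_sum0 i)))].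

Lemma map_of_homE F a (z : Zsum0 n.+1) :
  eval_map (map_of_hom F a) (val z) = F (\pi_(sandpile g) z).
Proof.
rewrite /eval_map; under eq_bigr do rewrite ffunE mulrzDl.
rewrite big_split /= -mulrz_sumr.
have /eqP -> : \sum_i val z i 0 == 0 by case: z.
rewrite mulr0z add0r.
have {2}-> : z = \sum_i MkZsum0 (diff_sum0 i) *~ val z i 0.
  apply: val_inj.
  transitivity (\sum_i (delta_mx i 0 - delta_mx 0 0) *~ val z i 0 : 'cV[int]_n.+1); last first.
    by rewrite raddf_sum; apply: eq_bigr => i _; rewrite raddfMz.
  rewrite /= {1}[Zsum0_val z]matrix_sum_delta; under [RHS]eq_bigr do rewrite mulrzBl.
  rewrite sumrB -mulrz_sumr (_ : \sum_i val z i 0 = 0) ?mulr0z ?subr0.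
    by apply: eq_bigr => i _; rewrite big_ord1 -[X in X *: _]intz scaler_int.
  by case: z => z /= /eqP.
by rewrite !raddf_sum; apply: eq_bigr => i _; rewrite !raddfMz.
Qed.

Lemma map_of_hom_kills F a : kills_laplacian S g (map_of_hom F a).
Proof.
apply/kills_laplacianP => w.
have wz : L *m w \in @sum0 n.+1 by apply: (@col_image_laplacian_sum0 _ g); apply/asboolP; exists w.
rewrite -[L *m w]/(val (MkZsum0 wz)) map_of_homE.
rewrite -[RHS](raddf0 F) -[in RHS](raddf0 (\pi_(sandpile g))); congr (F _).
by apply/eqP; rewrite -Quotient.idealrBE subr0; apply/asboolP; exists w.
Qed.

Lemma map_of_hom_inj F a F' a' : map_of_hom F a = map_of_hom F' a' -> (F, a) = (F', a').
Proof.
move=> eq; congr (_, _).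
  apply: additive_ext => s; rewrite -[s]reprK -(map_of_homE F a) -(map_of_homE F' a').
  by rewrite eq.
have base0 (H : {additive sandpile g -> G}) : H (\pi_(sandpile g) (MkZsum0 (diff_sum0 0))) = 0.
  rewrite (_ : MkZsum0 _ = 0) ?raddf0 //.
  by apply: val_inj; rewrite /= subrr.
by have /ffunP/(_ 0) := eq; rewrite !ffunE !base0 !addr0.
Qed.

Lemma hom_of_map f : kills_laplacian S g f -> exists F a, f = map_of_hom F a.
Proof.
move=> /kills_laplacianP kf.
pose h (z : Zsum0 n.+1) := eval_map f (val z).
have hB : zmod_morphism h by move=> z z'; rewrite /h raddfB -raddfB.
pose H : {additive _ -> _} := HB.pack h (GRing.isZmodMorphism.Build _ _ h hB).
have [z zL|F FE] := @quot_lift _ _ (lap_image g) H.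
  by move: zL => /asboolP[w zw]; rewrite /= /h zw kf.
exists F, (f 0); apply/ffunP => i; rewrite ffunE FE /= /h /= raddfB /=.
have ed j : eval_map f (delta_mx j 0) = f j.
  rewrite /eval_map (bigD1 j) //= big1 ?addr0 ?mxE ?eqxx // => k /negPf kj.
  by rewrite mxE kj.
by rewrite !ed addrC subrK.
Qed.

Lemma map_of_hom_generates F a :
  generates (map_of_hom F a) <-> (forall b : G, exists s : sandpile g, F s = b).
Proof.
split=> [/asboolP gen b|sur].
  by have [z <-] := gen b; exists (\pi_(sandpile g) z); rewrite -(map_of_homE F a).
apply/asboolP => b; have [s <-] := sur b; exists (repr s).
by rewrite map_of_homE reprK.
Qed.

(** The functional w -> x_k(f w)/m_k descends to cok(L) because f L = 0, and there it extends the
    transpose of the k-th basis character; the row of the x_k(f_i)/m_k lifts it. *)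
Lemma sandpile_pairing_basis F a (k l : 'I_r) :
  sandpile_pairing (transpose F (dual_basis (S := S) k)) (transpose F (dual_basis l)) =
  \pi_QmodZ (hom_form g (map_of_hom F a) k l).
Proof.
set f := map_of_hom F a; have kf := map_of_hom_kills F a.
have ex (j : 'I_r) : exists t : dualQZ (cok L),
    restriction t = transpose F (dual_basis j) /\ is_lift t (\row_i (X (f i) j / (m j)%:R)).
  have [w /asboolP[v ->]|t tE] := @quot_lift _ _ (col_image L)
      ((dual_basis j : dualQZ G) \o eval_map f : {additive _ -> _}).
    rewrite /=; move/kills_laplacianP: kf => ->; exact: raddf0.
  exists t; split=> [|i].
    apply: additive_ext => s; rewrite -[s]reprK /= sandpile_incl_funE tE /= map_of_homE //.
  rewrite tE mxE /= /eval_map (bigD1 i) //= big1 ?addr0 ?mxE ?eqxx //.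
  by move=> i' /negPf ii; rewrite mxE ii.
have [tk [rk lk]] := ex k; have [tl [rl ll]] := ex l.
rewrite (sandpile_pairingE rk rl) (cok_pairingE (laplacian_sym g) lk ll); congr (\pi _).
have LE i j : (map_mx intr L : 'M[rat]_n.+1) i j = (L i j)%:~R by rewrite [LHS]mxE.
rewrite /hom_form /lap_form [LHS]mxE mulr_suml; apply: eq_bigr => j _.
rewrite [_^T j 0]mxE [(\row_i _) 0 j]mxE [(_ *m _) 0 j]mxE !mulr_suml; apply: eq_bigr => i _.
rewrite LE [(\row_i _) 0 i]mxE.
by have := cord_neq0 k; have := cord_neq0 l => ? ?; field; apply/andP.
Qed.

Lemma map_of_hom_realizes F a :
  realizes_form (pairing_lift (S := S) bG) g (map_of_hom F a) <->
  (forall u v : dualQZ G, sandpile_pairing (transpose F u) (transpose F v) = bG u v).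
Proof.
split=> [/forallP real|real].
  apply: (@symmetric_pairing_ext G S
    (fun u v => sandpile_pairing (transpose F u) (transpose F v))) => [|//|k l kl].
    have tB (u v : dualQZ G) : transpose F (u - v) = transpose F u - transpose F v.
      exact: additive_ext.
    have [p1 p2 p3] := sandpile_pairing_sym g.
    by split=> [u v w|u v w|u v]; rewrite ?tB ?p1 ?p2 // p3.
  rewrite (sandpile_pairing_basis F a) -[RHS]reprK; apply/piQZ_eq.
  by have := real (k, l); rewrite /= kl.
apply/forallP => p; apply/implyP => _; apply/piQZ_eq.
by rewrite -(sandpile_pairing_basis F a) real reprK.
Qed.

Definition good_map f : bool :=
  [&& generates f, kills_laplacian S g f & realizes_form (pairing_lift (S := S) bG) g f].

(** [map_of_hom] is a bijection from the pairs (F, a) with F in [Sur_star] onto the good maps. *)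
Lemma card_good_maps : #|[pred f | good_map f]| = (#|G| * card_Sur_star g bG)%N.
Proof.
pose s := [seq map_of_hom F a | F <- enum_fset (fset_set (Sur_star g bG)), a <- enum G].
have su : uniq s.
  apply: allpairs_uniq; rewrite ?enum_uniq ?fset_uniq //.
  by move=> [F a] [F' a'] _ _ /= /map_of_hom_inj.
have mem F : (F \in enum_fset (fset_set (Sur_star g bG))) <-> Sur_star g bG F.
  have E : (F \in enum_fset (fset_set (Sur_star g bG))) = (F \in Sur_star g bG).
    by apply: in_fset_set; exact: finite_Sur_star.
  by rewrite E; split=> [/set_mem|/mem_set].
transitivity (size s); last by rewrite size_allpairs -cardE mulnC.
rewrite -(card_uniqP su); apply: eq_card => f; rewrite inE /=.
apply/idP/allpairsP => [/and3P[gen kil real]|[[F a] [/= /mem[sur pai] _ ->]]].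
  have [F [a fE]] := hom_of_map kil; exists (F, a); split; rewrite /= ?mem_enum //.
  apply/mem; rewrite fE in gen real; split; first exact: (map_of_hom_generates F a).1.
  exact: (map_of_hom_realizes F a).1.
apply/and3P; split; first exact: (map_of_hom_generates F a).2.
  exact: map_of_hom_kills.
exact: (map_of_hom_realizes F a).2.
Qed.

End FixedGraph.
End SurReduction.

(** * The limit *)

Section MainTerm.
Variables (R : realType) (q : R).
Hypotheses (q_gt0 : 0 < q) (q_lt1 : q < 1).
Variables (G : finZmodType) (S : cyclic_coords G).
Local Notation r := (crank S).
Local Notation m := (@cord G S).
Local Notation e := (@cbasis G S).
Local Notation x := (@coord G S).
Local Notation X := (@X G S).

(** The character belonging to c - c' is constant on the values of f, hence 0 on combinations of
    coordinate sum 0, and these fill [G]. *)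
Lemma generates_separating n (f : {ffun 'I_n.+1 -> G}) :
  generates f -> separating S (f @: 'I_n.+1).
Proof.
move=> /asboolP gen c c' cc.
pose v : dualQZ G := \sum_k dual_basis k *~ ((x c k)%:Z - (x c' k)%:Z).
have vE g : v g = \pi_QmodZ (\sum_k (X c k - X c' k) * X g k / (m k)%:R).
  rewrite hom_sumE raddf_sum; apply: eq_bigr => k _; rewrite hom_mulrzE dual_basisE -raddfMz.
  by congr (\pi _); rewrite -mulrzr rmorphB /= -!pmulrn -/(X g k) -/(X c k) -/(X c' k); ring.
have vf i : v (f i) = v (f 0).
  rewrite !vE; apply/piQZ_eq; have := cc (f i) (f 0) (imset_f _ isT) (imset_f _ isT).
  by congr (_ \is a Num.int); rewrite /coord_prod -sumrB; apply: eq_bigr => k _; ring.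
have v0 a : v a = 0.
  have [z <-] := gen a; rewrite /eval_map raddf_sum.
  under eq_bigr do rewrite raddfMz /= vf.
  by rewrite -mulrz_sumr (_ : \sum_i _ = 0) ?mulr0z //; case: z => z /= /eqP.
apply: (@coord_inj _ S) => k; apply: (@natr_eq_mod _ _ (m k)); rewrite ?coord_lt //.
have zi j : X c j - X c' j \is a Num.int by rewrite rpredB ?X_int.
have := v0 (e k); rewrite vE => /piQZ_eq0 h.
have := rpredB h (@sum_X_basis _ S (fun j => X c j - X c' j) k (zi k)).
by rewrite opprB addrCA subrr addr0.
Qed.

Lemma surjective_generates n (f : {ffun 'I_n.+1 -> G}) :
  (forall a, exists i, f i = a) -> generates f.
Proof.
move=> sur; apply/asboolP => a; have [i fi] := sur a; have [j fj] := sur 0.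
exists (MkZsum0 (diff_sum0 i) - MkZsum0 (diff_sum0 j)).
have ed k : eval_map f (delta_mx k 0) = f k.
  rewrite /eval_map (bigD1 k) //= big1 ?addr0 ?mxE ?eqxx // => l /negPf kl.
  by rewrite mxE kl.
have evB w w' : eval_map f (w - w') = eval_map f w - eval_map f w' by exact: raddfB.
by rewrite raddfB /= !evB !ed fi fj opprB addrA subrK subr0.
Qed.

Variable kappa : 'I_r * 'I_r -> nat.
Local Notation cp := (compat S kappa).
Local Notation N := #|G|.

Definition psi_prod n (t : {ffun 'I_n -> G * G}) : R[i] :=
  \prod_(p : 'I_n * 'I_n | (p.1 < p.2)%N) psi q (- theta S kappa (t p.1) (t p.2)).

(** There are finitely many pairs of labels, so one rho serves all incompatible ones. *)
Lemma psi_prod_bound : exists rho : R, [/\ 0 < rho, rho < 1 &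
  forall n (t : {ffun 'I_n -> G * G}), `|psi_prod t| <= (pair_weight cp rho t)%:C%C].
Proof.
(* The modulus is a complex number with zero imaginary part; [Re] makes it an element of [R]. *)
pose F (u : (G * G) * (G * G)) : R := complex.Re `|psi q (- theta S kappa u.1 u.2)|.
have FE u : ~~ cp u.1 u.2 -> F u < 1 /\ `|psi q (- theta S kappa u.1 u.2)| = (F u)%:C%C.
  rewrite /compat -rpredN => h; have [y y1 yE] := norm_psi_lt1 q_gt0 q_lt1 h.
  by rewrite /F yE.
have [rho [rho0 rho1 Fr]] : exists rho, [/\ 0 < rho, rho < 1 &
    forall u, ~~ cp u.1 u.2 -> F u <= rho ^+ 2].
  by apply: (@finite_lt1_bound _ _ (fun u => ~~ cp u.1 u.2)) => u /FE[].
exists rho; split=> // n t.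
rewrite /pair_weight pair_bigA big_ord_pairs /= [X in _ * X]big1 ?mulr1; last first.
  by move=> i _; rewrite compat_refl.
rewrite rmorph_prod /psi_prod normr_prod; apply: ler_prod => p _; rewrite normr_ge0 /=.
rewrite (compat_sym _ (t p.2)); case: ifPn => h.
  by rewrite mulr1 psi_int ?normr1 // rpredN.
by have [_ ->] := FE (t p.1, t p.2) h; rewrite lecR -expr2 Fr.
Qed.

(** For the relation that always holds, full cliques of size |G| are the surjective maps; in this
    form [mean_field] also shows that almost all maps are onto. *)
Definition onto n (f : {ffun 'I_n -> G}) : bool := full_clique (fun _ _ => true) N f.

Lemma ontoP n (f : {ffun 'I_n -> G}) : reflect (forall a, exists i, f i = a) (onto f).
Proof.
apply: (iffP andP) => [[_ /eqP fN] a|sur].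
  have : f @: 'I_n = finset.setT.
    by apply/eqP; rewrite eqEcard finset.subsetT cardsT fN /=.
  by move=> /setP/(_ a); rewrite inE => /imsetP[i _ ->]; exists i.
split; first by apply/cliqueP.
rewrite -cardsT; apply/eqP; congr #|pred_of_set _|; apply/setP => a; rewrite inE.
by have [i <-] := sur a; apply: imset_f.
Qed.

Definition graph_map n (u : {ffun G -> G} * {ffun 'I_n -> G}) : {ffun 'I_n -> G * G} :=
  [ffun i => (u.1 (u.2 i), u.2 i)].

(** Generation makes the image separating, hence the graph of some gam; then t is the pair (gam o f,
    f) with f onto. Conversely an onto map generates. *)
Lemma card_main_terms n :
  #|[pred t : {ffun 'I_n.+1 -> G * G} | generates [ffun i => (t i).2] && full_clique cp N t]|
  = (#|graph_cliques S kappa| * #|[pred f : {ffun 'I_n.+1 -> G} | onto f]|)%N.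
Proof.
pose O : {set {ffun 'I_n.+1 -> G}} := finset (fun f => onto f).
have -> : #|[pred f : {ffun 'I_n.+1 -> G} | onto f]| = #|O|.
  by apply: eq_card => f; rewrite /O !inE.
rewrite -cardsX -(card_in_imset (f := @graph_map n.+1)); last first.
  move=> [ga f] [ga' f']; rewrite !finset.in_setX /O /= !inE => /andP[_ /ontoP sf] _ /ffunP eq.
  have ff : f = f' by apply/ffunP => i; have := eq i; rewrite !ffunE /= => -[].
  congr (_, _) => //; apply/ffunP => a; have [i <-] := sf a.
  by have := eq i; rewrite !ffunE /= -ff => -[].
apply: eq_card => t; rewrite inE; apply/andP/imsetP => [[gen /andP[ct /eqP tN]]|[[ga f]]].
  have [|gam gG tE] := full_clique_graph ct tN.
    have -> : snd @: (t @: 'I_n.+1) = [ffun i => (t i).2] @: 'I_n.+1.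
      by rewrite -imset_comp; apply: eq_imset => i; rewrite ffunE.
    exact: generates_separating.
  exists (gam, [ffun i => (t i).2]); last first.
    apply/ffunP => i; rewrite !ffunE /=.
    have : t i \in graph_set gam by rewrite -tE imset_f.
    by move=> /imsetP[f _ ->].
  rewrite finset.in_setX gG /O inE; apply/ontoP => a.
  have : (gam a, a) \in t @: 'I_n.+1 by rewrite tE; apply: imset_f.
  by move=> /imsetP[i _ ti]; exists i; rewrite ffunE -ti.
rewrite finset.in_setX /O inE => /andP[/= gG /ontoP sf] ->.
have -> : [ffun i => (graph_map (ga, f) i).2] = f by apply/ffunP => i; rewrite !ffunE.
split; first exact: surjective_generates.
have im : graph_map (ga, f) @: 'I_n.+1 = graph_set ga.
  apply/setP => s; apply/imsetP/imsetP => [[i _ ->]|[a _ ->]].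
    by exists (f i); rewrite // ffunE.
  by have [i <-] := sf a; exists i; rewrite // ffunE.
rewrite /full_clique im; apply/andP; split; last by rewrite card_imset // => a a' [].
apply/cliqueP => _ _ /imsetP[a _ ->] /imsetP[a' _ ->].
by move: gG; rewrite /graph_cliques inE => /forallP/(_ a)/forallP.
Qed.

(** Terms on full cliques equal 1 and are counted by [card_main_terms]. The error comes from the t
    that are not full cliques and from the f that are not onto; [mean_field] bounds both. *)
Lemma main_term_error : exists2 d : nat -> R, (d n @[n --> \oo] --> (0 : R))%classic &
  forall n, `|N%:R ^- n.+1 * \sum_(t : {ffun 'I_n.+1 -> G * G} | generates [ffun i => (t i).2]) psi_prod t
     - #|graph_cliques S kappa|%:R| <= (d n.+1)%:C%C.
Proof.
have [rho [rho0 rho1 bound]] := psi_prod_bound.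
have N0 : (0 < N)%N by apply/card_gt0P; exists 0.
pose d1 n := N%:R ^- n * (\sum_(t : {ffun 'I_n -> G * G} | ~~ full_clique cp N t) pair_weight cp rho t) : R.
pose d2 n := N%:R ^- n * (\sum_(f : {ffun 'I_n -> G} | ~~ onto f) pair_weight (fun _ _ => true) rho f) : R.
have d1_cvg : (d1 n @[n --> \oo] --> (0 : R))%classic.
  apply: mean_field => //; [exact: compat_sym|exact: compat_refl|exact: (clique_card_le R)].
have d2_cvg : (d2 n @[n --> \oo] --> (0 : R))%classic.
  by apply: mean_field => // A _; apply: max_card.
exists (fun n => d1 n + #|graph_cliques S kappa|%:R * d2 n).
  rewrite -[X in (_ --> X)%classic]addr0; apply: cvgD => //.
  by rewrite -[X in (_ --> X)%classic](mulr0 #|graph_cliques S kappa|%:R); apply: cvgMr.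
move=> n; set Gam := #|graph_cliques S kappa|.
have NC : N%:R ^+ n.+1 != 0 :> R[i] by rewrite expf_neq0 // pnatr_eq0 -lt0n.
rewrite (bigID (fun t => full_clique cp N t)) /=.
have -> : \sum_(t : {ffun 'I_n.+1 -> G * G} | generates [ffun i => (t i).2] && full_clique cp N t)
    psi_prod t = Gam%:R * (N%:R ^+ n.+1 - #|[pred f : {ffun 'I_n.+1 -> G} | ~~ onto f]|%:R).
  rewrite (eq_bigr (fun=> 1)); last first.
    move=> t /andP[_ /andP[ct _]]; rewrite /psi_prod big1 // => p _; rewrite psi_int // rpredN.
    by apply: (cliqueP _ _ ct); apply: imset_f.
  rewrite sumr_const card_main_terms natrM; congr (_ * _).
  have := cardC [pred f : {ffun 'I_n.+1 -> G} | onto f].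
  rewrite card_ffun card_ord => /(congr1 (fun k => k%:R : R[i])).
  by rewrite natrD natrX => <-; rewrite addrK.
set bad := \sum_(t | _) _.
have -> : N%:R ^- n.+1 * (Gam%:R * (N%:R ^+ n.+1 - #|[pred f : {ffun 'I_n.+1 -> G} | ~~ onto f]|%:R) + bad) - Gam%:R
   = N%:R ^- n.+1 * bad - Gam%:R * (N%:R ^- n.+1 * #|[pred f : {ffun 'I_n.+1 -> G} | ~~ onto f]|%:R).
  by field.
apply: le_trans (ler_normB _ _) _; rewrite rmorphD /=; apply: lerD.
  rewrite normrM /d1 rmorphM /= ger0_norm; last by rewrite invr_ge0 exprn_ge0.
  rewrite fmorphV rmorphXn /= rmorph_nat; apply: ler_wpM2l; first by rewrite invr_ge0 exprn_ge0.
  apply: le_trans (ler_norm_sum _ _ _) _; rewrite rmorph_sum /=.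
  rewrite [leLHS]big_mkcond [leRHS]big_mkcond /=; apply: ler_sum => t _.
  case: (full_clique cp N t); rewrite ?andbF ?andbT //=; case: ifP => _ //.
  by apply: le_trans (bound _ t); apply: normr_ge0.
rewrite ger0_norm; last by rewrite !mulr_ge0 // invr_ge0 exprn_ge0.
rewrite rmorphM /= rmorph_nat; apply: ler_wpM2l => //.
rewrite /d2 rmorphM /= fmorphV rmorphXn /= rmorph_nat; apply: ler_wpM2l.
  by rewrite invr_ge0 exprn_ge0.
rewrite rmorph_sum /= (eq_bigr (fun=> 1)) ?sumr_const //.
by move=> f _; rewrite /pair_weight big1 ?rmorph1 // => i _; rewrite big1.
Qed.

End MainTerm.

Lemma cvg_sum0 (R : realType) (I : finType) (d : I -> nat -> R) :
  (forall i, (d i n @[n --> \oo] --> (0 : R))%classic) ->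
  ((\sum_i d i n) @[n --> \oo] --> (0 : R))%classic.
Proof.
move=> dc; elim: (index_enum I) => [|i s IH].
  by rewrite (_ : (fun n => _) = cst 0); [exact: cvg_cst|apply/funext => n; rewrite big_nil].
rewrite (_ : (fun n => _) = (fun n => d i n + \sum_(j <- s) d j n)); last first.
  by apply/funext => n; rewrite big_cons.
by rewrite -[X in (_ --> X)%classic]addr0; apply: cvgD.
Qed.

Local Open Scope classical_set_scope.

Theorem theorem1p2 (R : realType) (q : R) (q_gt0 : 0 < q) (q_lt1 : q < 1)
    (G : finZmodType) (bG : dualQZ G -> dualQZ G -> QmodZ)
    (bG_pairing : symmetric_pairing bG) :
  gnq_expectation q (fun g : sgraph n => (card_Sur_star g bG)%:R) @[n --> \oo]
    --> (#|G|%:R^-1 : R).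
Proof.
have [S] := cyclic_coords_exist G.
pose fam := weight_family (@sym_weight G S); pose b := pairing_lift (S := S) bG.
pose nk (kappa : {ffun 'I_(crank S) * 'I_(crank S) -> 'I_(index_bound S)}) p := kappa p : nat.
have [d dP] := boolp.choice (fun kappa => let: ex_intro2 d h1 h2 :=
   main_term_error q_gt0 q_lt1 (nk kappa) in ex_intro (fun d =>
   d n @[n --> \oo] --> (0 : R) /\
   forall n, `|#|G|%:R ^- n.+1 * \sum_(t : {ffun 'I_n.+1 -> G * G} | generates [ffun i => (t i).2])
     psi_prod q (nk kappa) t - #|graph_cliques S (nk kappa)|%:R| <= (d n.+1)%:C%C) d (conj h1 h2)).
pose D n := \sum_kappa d kappa n.
have D_cvg : D n @[n --> \oo] --> (0 : R) by apply: cvg_sum0 => kappa; case: (dP kappa).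
pose W : R[i] := (\prod_p @sym_weight G S p)%N%:R; pose N : R[i] := #|G|%:R.
have sw_gt0 p : (0 < @sym_weight G S p)%N.
  by rewrite /sym_weight; case: ifP => // _; exact: cgcd_gt0.
have W_ge1 : 1 <= W by rewrite ler1n prodn_gt0.
have N_ge1 : 1 <= N by rewrite ler1n; apply/card_gt0P; exists 0.
have W0 : W != 0 by rewrite gt_eqF // (lt_le_trans ltr01).
have N0 : N != 0 by rewrite gt_eqF // (lt_le_trans ltr01).
pose ph kappa := ec R (- \sum_p (nk kappa p)%:R * b p).
(* Only kappa = 0 admits graph cliques, and their number, |G| times the product of [alt_weight], is
   W. *)
have limE : N^-1 = N^-1 * W^-1 * \sum_(kappa in fam) ph kappa * #|graph_cliques S (nk kappa)|%:R.
  pose k0 : {ffun 'I_(crank S) * 'I_(crank S) -> 'I_(index_bound S)} := [ffun=> ord0].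
  have k0E : nk k0 = fun=> 0%N by apply/funext => p; rewrite /nk ffunE.
  rewrite (bigD1 k0) /=; last by apply/weight_familyP => p; rewrite ffunE.
  rewrite big1 ?addr0 => [|kappa /andP[/weight_familyP kf kn0]]; last first.
    have [->|[gam gamG]] := set_0Vmem (graph_cliques S (nk kappa)).
      by rewrite cards0 mulr0.
    case/eqP: kn0; apply/ffunP => p; apply: val_inj; rewrite ffunE.
    exact: (kappa_eq0 gamG kf).
  rewrite /ph k0E card_graph_cliques0 -sym_alt_weight big1 ?oppr0 ?ec0 ?mul1r => [|p _].
    by rewrite mulfVK.
  by rewrite mul0r.
(* Each surjection is counted by |G| vertex maps, which is the origin of the factor [N^-1]. *)
have expE n : (gnq_expectation q (fun g : sgraph n.+1 => (card_Sur_star g bG)%:R : R))%:C%C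
    = N^-1 * W^-1 * \sum_(kappa in fam) ph kappa * (N ^- n.+1 *
        \sum_(t : {ffun 'I_n.+1 -> G * G} | generates [ffun i => (t i).2]) psi_prod q (nk kappa) t).
  have b_ord (p : 'I_(crank S) * 'I_(crank S)) : (p.1 <= p.2)%N -> (cgcd p.1 p.2)%:R * b p \is a Num.int.
    by move=> _; exact: pairing_lift_ord.
  rewrite /gnq_expectation rmorph_sum /=.
  transitivity (N^-1 * \sum_(g : sgraph n.+1) (gnq_weight q g)%:C%C *
     \sum_(f : {ffun 'I_n.+1 -> G} | generates f)
        ((kills_laplacian S g f && realizes_form b g f)%:R : R[i])).
    rewrite mulr_sumr; apply: eq_bigr => g _; rewrite rmorphM mulrCA; congr (_ * _).
    have -> : \sum_(f : {ffun 'I_n.+1 -> G} | generates f)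
        ((kills_laplacian S g f && realizes_form b g f)%:R : R[i])
        = N * (card_Sur_star g bG)%:R.
      rewrite /N -natrM -(card_good_maps S bG_pairing g) -sum1_card natr_sum.
      rewrite big_mkcond [RHS]big_mkcond; apply: eq_bigr => f _.
      rewrite inE /good_map; case: (generates f) => //=.
      by case: (_ && _).
    by rewrite mulKf // rmorph_nat.
  rewrite (expected_good_maps b_ord q) -!mulrA; congr (_ * _).
  rewrite mulrCA; congr (_ * _); rewrite mulr_sumr; apply: eq_bigr => kappa _.
  by rewrite mulrCA.
have bound n : `|gnq_expectation q (fun g : sgraph n.+1 => (card_Sur_star g bG)%:R)
     - #|G|%:R^-1 : R| <= D n.+1.
  rewrite -lecR; set y := (X in `|X|).
  apply: le_trans (normc_ge_Re (y%:C)%C) _.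
  have -> : (y%:C)%C = N^-1 * W^-1 * \sum_(kappa in fam) ph kappa * (N ^- n.+1 *
        (\sum_(t : {ffun 'I_n.+1 -> G * G} | generates [ffun i => (t i).2])
            psi_prod q (nk kappa) t) - #|graph_cliques S (nk kappa)|%:R).
    rewrite /y rmorphB /= fmorphV rmorph_nat -/N expE [X in _ - X]limE -mulrBr -sumrB.
    by congr (_ * _); apply: eq_bigr => kappa _; rewrite mulrBr.
  rewrite normrM; set s := \sum_(kappa in fam) _.
  (* Prefactor and phases have modulus at most 1, so the error is at most the sum of the errors for
     the individual kappa. *)
  have NW1 : `|N^-1 * W^-1| <= 1.
    rewrite ger0_norm; last by rewrite mulr_ge0 // invr_ge0 (le_trans ler01).
    by rewrite mulr_ile1 ?invr_ge0 ?invf_le1 ?(le_trans ler01) // (lt_le_trans ltr01).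
  apply: (@le_trans _ _ `|s|); first by rewrite ler_piMl.
  apply: le_trans (ler_norm_sum _ _ _) _; rewrite /D rmorph_sum /= [leLHS]big_mkcond.
  apply: ler_sum => kappa _; have [_ /(_ n) dk] := dP kappa.
  case: ifP => _; last by apply: le_trans dk; apply: normr_ge0.
  by rewrite normrM norm_ec mul1r.
apply/subr_cvg0; apply/cvgr0Pnorm_le => eps eps0.
move/cvgr0Pnorm_le: D_cvg => /(_ eps eps0) De.
(* The correspondence with vertex maps uses vertex 0, so n must be positive. *)
near=> n; have [n1 n1E] : exists n1, n = n1.+1.
  exists n.-1; rewrite prednK //; near: n; by exists 1%N.
have : `|D n| <= eps by near: n.
by rewrite n1E => /(le_trans (ler_norm _)); apply: le_trans (bound n1).
Unshelve. all: by end_near. Qed.
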